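(* Let $X_0\in\Sigma_{\rm invariant}$ and $\phi_0\in C(\Sigma,\mathbb{R})$. Suppose that all equilibrium states of $\phi_0|_{X_0}$ have non-zero entropy. Then the generalized pressure function $$P:\Sigma_{\rm invariant}\times C(\Sigma,\mathbb{R})\to\mathbb{R},\qquad (X,\phi)\mapsto P_{\rm top}(X,\phi|_X),$$ is not computable at $(X_0,\phi_0)$.
   Context: $\Sigma=\mathcal{A}^{\mathbb{Z}}$ is the full two-sided shift over the finite alphabet $\mathcal{A}=\{0,\dots,d-1\}$ with the product topology, and $f$ is the left shift. $\Sigma_{\rm invariant}$ is the set of (nonempty) shift spaces, i.e., closed shift-invariant subsets $X\subset\Sigma$. $\mathcal{L}(X,n)$ is the set of words of length $n$ occurring in points of $X$; the language is $\mathcal{L}(X)=\bigcup_n\mathcal{L}(X,n)$. For $\phi\in C(X,\mathbb{R})$ the topological pressure is $P_{\rm top}(X,\phi)=\lim_{n\to\infty}\frac1n\log\sum_{\tau\in\mathcal{L}(X,n)}\exp\big(\sup_{x\in[\tau]}\sum_{k=0}^{n-1}\phi(f^k(x))\big)$, $[\tau]=\{x\in X:x_0\cdots x_{n-1}=\tau\}$; by the variational principle it equals $\sup_\mu\big(h_\mu(f)+\int\phi\,d\mu\big)$ over the $f$-invariant Borel probability measures $\mu$ on $X$, and an equilibrium state of $\phi$ is a measure $\mu$ attaining this supremum. An oracle for $X\in\Sigma_{\rm invariant}$ is a function which on input $n$ returns the finite list of all admissible words of $X$ of length $2n+1$ (equivalently, it lists the language of $X$ in order of nondecreasing length). An oracle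 for $\phi\in C(\Sigma,\mathbb{R})$ is a function which on input $n$ returns a rational-valued locally constant function $\chi(n)$ on $\Sigma$ (depending on the coordinates $x_{-k},\dots,x_k$ for some $k$) with $\|\chi(n)-\phi\|_\infty<2^{-n}$. The function $P$ is computable at $(X_0,\phi_0)$ if there is an oracle Turing machine such that, given any oracles for $X_0$ and $\phi_0$ and any $n\in\mathbb{N}$, it outputs a rational $q$ with $|q-P(X_0,\phi_0)|<2^{-n}$, and moreover $|q-P(X,\phi)|<2^{-n}$ for every $(X,\phi)\in\Sigma_{\rm invariant}\times C(\Sigma,\mathbb{R})$ having oracles which agree with the given ones up to the largest precision queried in that computation. *)

(* Defs.v *)
From HB Require Import structures.
From mathcomp Require Import all_boot all_order all_algebra.
From mathcomp Require Import all_classical all_reals all_analysis.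
Set Implicit Arguments.
Unset Strict Implicit.
Unset Printing Implicit Defensive.
Import Order.TTheory GRing.Theory Num.Theory.
Import numFieldNormedType.Exports.
Local Open Scope classical_set_scope.
Local Open Scope ring_scope.

(* The alphabet is 'I_d.+1: a measurable space must be inhabited in the library,
   and over an empty alphabet there is no nonempty shift space. *)
HB.instance Definition _ d := isPointed.Build 'I_d.+1 ord0.

Definition full_shift (d : nat) : Type :=
  prod_topology (fun _ : int => discrete_topology 'I_d.+1).

HB.instance Definition _ d := Pointed.on (full_shift d).
HB.instance Definition _ d := Topological.on (full_shift d).

Definition shift d (x : full_shift d) : full_shift d := fun i => x (i + 1).

(* The word x_m x_(m+1) ... x_(m+n-1). *)
Definition block d (x : full_shift d) (m : int) (n : nat) : n.-tuple 'I_d.+1 :=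
  [tuple x (m + (i : nat)%:Z) | i < n].

(* Invariance of a two-sided shift space is the equality f(X) = X. *)
Definition shift_space d (X : set (full_shift d)) : Prop :=
  [/\ X !=set0, closed X & @shift d @` X = X].

Definition language d (X : set (full_shift d)) (n : nat) : set (n.-tuple 'I_d.+1) :=
  [set w | exists2 x, X x & exists m : int, block x m n = w].
Arguments language {d} X n _.

Definition cylinder d (X : set (full_shift d)) (n : nat) (w : n.-tuple 'I_d.+1) :
    set (full_shift d) :=
  [set x | X x /\ block x 0 n = w].

Section pressure.
Context {R : realType} {d : nat}.
Implicit Types (X : set (full_shift d)) (phi : full_shift d -> R).

Definition birkhoff_sum phi (n : nat) (x : full_shift d) : R :=
  \sum_(k < n) phi (iter k (@shift d) x).

Definition pressure X phi : R :=
  limn (fun n : nat => n%:R^-1 *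
    ln (\sum_(w : n.-tuple 'I_d.+1 | w \in language X n)
          expR (sup [set birkhoff_sum phi n x | x in cylinder X w])) : R).

End pressure.

Definition borel_shift (d : nat) := g_sigma_algebraType (@open (full_shift d)).

Section equilibrium.
Context {R : realType} {d : nat}.
Implicit Types (X : set (full_shift d)) (phi : full_shift d -> R).
Implicit Types (mu : probability (borel_shift d) R).

(* A Borel probability measure on the closed set X is represented by the Borel
   probability measure on the full shift that gives X full mass. *)
Definition invariant_measure X mu : Prop :=
  mu X = 1%E /\
  forall A : set (borel_shift d), measurable A -> mu (@shift d @^-1` A) = mu A.

(* A finite measurable partition is given by its labelling map xi; empty atoms are
   harmless, as they contribute 0 to the entropy. *)
Definition measurable_partition (k : nat) (xi : full_shift d -> 'I_k) : Prop :=
  forall a : 'I_k, measurable (xi @^-1` [set a] : set (borel_shift d)).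

Definition itinerary (k : nat) (xi : full_shift d -> 'I_k) (n : nat)
    (x : full_shift d) : n.-tuple 'I_k :=
  [tuple xi (iter i (@shift d) x) | i < n].

(* The atoms of the join of the f^-i(xi), i < n, are the fibres of the itinerary
   map. The library has ln 0 = 0, hence null atoms contribute 0. *)
Definition join_entropy mu (k : nat) (xi : full_shift d -> 'I_k) (n : nat) : R :=
  - \sum_(w : n.-tuple 'I_k)
      let p := fine (mu (itinerary xi n @^-1` [set w])) in p * ln p.

Definition partition_entropy mu (k : nat) (xi : full_shift d -> 'I_k) : R :=
  limn (fun n : nat => n%:R^-1 * join_entropy mu xi n : R).

(* Kolmogorov-Sinai entropy of the shift. *)
Definition entropy mu : \bar R :=
  ereal_sup [set h : \bar R | exists k (xi : full_shift d -> 'I_k),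
    measurable_partition xi /\ h = (partition_entropy mu xi)%:E].

Definition free_energy X phi mu : \bar R :=
  (entropy mu + \int[mu]_(x in X) (phi x)%:E)%E.

Definition equilibrium_state X phi mu : Prop :=
  invariant_measure X mu /\
  free_energy X phi mu =
    ereal_sup [set free_energy X phi nu | nu in invariant_measure X].

End equilibrium.

Definition shift_oracle d (X : set (full_shift d))
    (O : forall n : nat, seq ((n.*2.+1).-tuple 'I_d.+1)) : Prop :=
  forall n, uniq (O n) /\ forall w, w \in O n <-> language X n.*2.+1 w.

(* Finite presentation (k, g) of the function x |-> g(x_(-k) ... x_k). *)
Definition loc_const (d : nat) : Type :=
  {k : nat & {ffun (k.*2.+1).-tuple 'I_d.+1 -> rat}}.

Definition loc_const_eval d (chi : loc_const d) (x : full_shift d) : rat :=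
  tagged chi (block x (- (tag chi)%:Z) (tag chi).*2.+1).

Definition sup_norm {R : realType} d (g : full_shift d -> R) : R :=
  sup [set `|g x| | x in [set: full_shift d]].

Definition potential_oracle {R : realType} d (phi : full_shift d -> R)
    (O : nat -> loc_const d) : Prop :=
  forall n, sup_norm (fun x => ratr (loc_const_eval (O n) x) - phi x) < 2 ^- n.

(* Symbols used to exchange data with a machine. Naturals are written in unary,
   a rational as (sign) numerator, denominator in lowest terms. *)
Inductive io_symbol (d : nat) := Letter of 'I_d.+1 | Tally | Minus | Comma.
Arguments Tally {d}.
Arguments Minus {d}.
Arguments Comma {d}.

Section encodings.
Context {d : nat}.
Implicit Types n : nat.

Definition enc_nat n : seq (io_symbol d) := nseq n Tally.

Definition enc_rat (q : rat) : seq (io_symbol d) :=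
  (if q < 0 then [:: Minus] else [::]) ++
  enc_nat `|numq q|%N ++ Comma :: enc_nat `|denq q|%N.

Definition enc_word n (w : n.-tuple 'I_d.+1) : seq (io_symbol d) :=
  map (@Letter d) w.

Definition enc_words n (s : seq (n.-tuple 'I_d.+1)) : seq (io_symbol d) :=
  flatten [seq rcons (enc_word w) Comma | w <- s].

Definition enc_loc_const (chi : loc_const d) : seq (io_symbol d) :=
  enc_nat (tag chi) ++ Comma ::
  flatten [seq enc_word w ++ Comma :: rcons (enc_rat (tagged chi w)) Comma
          | w <- enum {: ((tag chi).*2.+1).-tuple 'I_d.+1}].

End encodings.

(* Deterministic multitape Turing machines with two oracles. Every tape is infinite
   to the right, and a left move on cell 0 has no effect. *)
Inductive tape_id (k : nat) := IOTape | OracleTape | WorkTape of 'I_k.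
Arguments IOTape {k}.
Arguments OracleTape {k}.

Inductive direction := GoLeft | Stay | GoRight.

(* Q: states, G: tape symbols, T: tapes. [Act] maps the scanned symbols to the next
   state and, for each tape, the symbol to write and the head move. The two [Ask]
   instructions query an oracle and give the next state. *)
Inductive instruction (Q G T : Type) :=
  | Halt
  | Act of (T -> G) -> Q * (T -> G * direction)
  | AskShift of Q
  | AskPotential of Q.
Arguments Halt {Q G T}.
Arguments Act {Q G T}.
Arguments AskShift {Q G T}.
Arguments AskPotential {Q G T}.

(* A tape cell is blank ([None]) or holds an exchange or an auxiliary symbol. *)
Record oracle_TM (d : nat) := OracleTM {
  state : finType;
  aux_symbol : finType;
  work_tapes : nat;
  start : state;
  program : state ->
    instruction state (option (io_symbol d + aux_symbol)) (tape_id work_tapes)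
}.

Section execution.
Context {d : nat} (M : oracle_TM d).

Definition cell : Type := option (io_symbol d + aux_symbol M).

Record config := Config {
  cstate : state M;
  contents : tape_id (work_tapes M) -> nat -> cell;
  heads : tape_id (work_tapes M) -> nat
}.

Definition tape_of (s : seq (io_symbol d)) : nat -> cell :=
  fun i => nth None [seq Some (inl a) | a <- s] i.

Definition move_head (m : direction) (h : nat) : nat :=
  match m with GoLeft => h.-1 | Stay => h | GoRight => h.+1 end.

Definition init (n : nat) : config :=
  Config (start M)
    (fun t => tape_of (if t is IOTape then enc_nat n else [::])) (fun=> 0%N).

Definition act (delta : (tape_id (work_tapes M) -> cell) ->
      state M * (tape_id (work_tapes M) -> cell * direction)) (c : config) : config :=
  let r := delta (fun t => contents c t (heads c t)) in
  Config r.1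
    (fun t i => if i == heads c t then (r.2 t).1 else contents c t i)
    (fun t => move_head (r.2 t).2 (heads c t)).

Definition answer (s : state M) (a : seq (io_symbol d)) (c : config) : config :=
  Config s
    (fun t => if t is OracleTape then tape_of a else contents c t)
    (fun t => if t is OracleTape then 0%N else heads c t).

Variables (OX : forall n : nat, seq ((n.*2.+1).-tuple 'I_d.+1)).
Variables (Ophi : nat -> loc_const d).

(* [run c qs c']: the machine goes from c to c' and queries, in order, the precisions
   qs. The query is the natural number written on the oracle tape, which the answer
   overwrites; an ill-formed query blocks the machine. *)
Inductive run : config -> seq nat -> config -> Prop :=
  | run_refl c : run c [::] c
  | run_act c delta qs c' : program (cstate c) = Act delta ->
      run (act delta c) qs c' -> run c qs c'
  | run_ask_shift c s m qs c' : program (cstate c) = AskShift s ->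
      (forall i, contents c OracleTape i = tape_of (enc_nat m) i) ->
      run (answer s (enc_words (OX m)) c) qs c' -> run c (m :: qs) c'
  | run_ask_potential c s m qs c' : program (cstate c) = AskPotential s ->
      (forall i, contents c OracleTape i = tape_of (enc_nat m) i) ->
      run (answer s (enc_loc_const (Ophi m)) c) qs c' -> run c (m :: qs) c'.

Definition outputs (n : nat) (q : rat) (qs : seq nat) : Prop :=
  exists c, [/\ run (init n) qs c, program (cstate c) = Halt &
    forall i, contents c IOTape i = tape_of (enc_rat q) i].

End execution.

Definition oracles {R : realType} d (X : set (full_shift d)) (phi : full_shift d -> R)
    (OX : forall n : nat, seq ((n.*2.+1).-tuple 'I_d.+1)) (Ophi : nat -> loc_const d) :=
  shift_oracle X OX /\ potential_oracle phi Ophi.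

(* Agreement is required at every precision up to the largest element of qs. *)
Definition agree_up_to d (qs : seq nat)
    (OX OX' : forall n : nat, seq ((n.*2.+1).-tuple 'I_d.+1))
    (Ophi Ophi' : nat -> loc_const d) : Prop :=
  forall m k : nat, m \in qs -> (k <= m)%N -> OX k = OX' k /\ Ophi k = Ophi' k.

Definition computable_at {R : realType} d
    (P : set (full_shift d) -> (full_shift d -> R) -> R)
    (X0 : set (full_shift d)) (phi0 : full_shift d -> R) : Prop :=
  exists M : oracle_TM d, forall OX Ophi, oracles X0 phi0 OX Ophi ->
    forall n : nat, exists (q : rat) (qs : seq nat),
      [/\ outputs M OX Ophi n q qs,
          `|ratr q - P X0 phi0| < 2 ^- n &
          forall X phi, shift_space X -> continuous phi ->
            (exists OX' Ophi', oracles X phi OX' Ophi' /\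
               agree_up_to qs OX OX' Ophi Ophi') ->
            `|ratr q - P X phi| < 2 ^- n].

(* Main.v *)
(* Rauzy graph paths give, for each [l], a shift space with the same words of length
   at most 2l+1 as [X0] but only linearly many words of each length. A machine computing
   the pressure cannot distinguish [X0] from such approximants, so their pressures would
   converge to that of [X0]. As linearly many words carry no entropy, the pressure of an
   approximant is nearly the average of [phi0] along a single long orbit segment. An
   ultrafilter limit of these orbit segments is an invariant measure on [X0] whose
   integral of [phi0] is at least the pressure; by the upper bound in the variational
   principle it is an equilibrium state of zero entropy.

   The variational bound is a single application of Gibbs' inequality: the joint law of
   an itinerary and of the block read by it is compared with the product of the Gibbs
   weight of the block and of guesses for the labels, each made from the window around
   the corresponding coordinate. *)

Require Import Defs.
From HB Require Import structures.
From mathcomp Require Import all_boot all_order all_algebra.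
From mathcomp Require Import all_classical all_reals all_analysis.
From mathcomp Require Import measurable_realfun zify ring lra.
Set Implicit Arguments.
Unset Strict Implicit.
Unset Printing Implicit Defensive.
Import Order.TTheory GRing.Theory Num.Theory.
Import numFieldNormedType.Exports.
Local Open Scope classical_set_scope.
Local Open Scope ring_scope.

(** Linear growth comes from fixing one successor and one predecessor for each vertex of the Rauzy
    graph: a whole two-sided path is then determined by a single vertex. The orbit segments of the
    approximants need not lie in [X0]; it is enough that their windows of radius [n] are words of
    [X0], because [X0] is closed.

    The obstacle in the variational bound is that an arbitrary measurable partition is not
    determined by finitely many coordinates. A decoder predicts its labels from a window, with a
    small probability of error [delta]. Gibbs' inequality needs positive weight wherever the true
    law has mass, so the guess gives [1 - eta] to the prediction and [eta / k] to every other label.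
    A wrong prediction then costs [ln (eta / k)], which is harmless since [delta] is chosen after
    [eta]. No conditional entropies appear, and the number of coordinates in a window enters only
    through boundary terms that vanish after division by [n]. *)

Local Notation shift := Defs.shift.

(** * Topology of the full shift *)

Section topology.
Context {d : nat}.
Implicit Types (x y : full_shift d) (N : nat).

Definition window N x : (N.*2.+1).-tuple 'I_d.+1 := block x (- N%:Z) N.*2.+1.

Lemma block_eqP x y (m m' : int) n :
  block x m n = block y m' n <->
  forall i : nat, (i < n)%N -> x (m + i%:Z) = y (m' + i%:Z).
Proof.
split=> [e i ltin|e].
  by have := congr1 (fun t => tnth t (Ordinal ltin)) e; rewrite !tnth_mktuple.
by apply: eq_from_tnth => i; rewrite !tnth_mktuple; exact: e.
Qed.

Lemma window_eqP N x y :
  window N x = window N y <-> forall i : int, (`|i| <= N)%N -> x i = y i.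
Proof.
rewrite block_eqP; split=> [e i leiN|e i ltin]; last by apply: e; lia.
by have := e (absz (i + N%:Z)); rewrite (_ : - _ + _ = i); [apply|]; lia.
Qed.

Lemma iter_shift k x (i : int) : iter k (@shift d) x i = x (i + k%:Z).
Proof.
elim: k x => [|k IHk] x; first by rewrite addr0.
by rewrite iterSr IHk /shift -addrA -PoszD addn1.
Qed.

Lemma block_iter_shift k x m n :
  block (iter k (@shift d) x) m n = block x (m + k%:Z) n.
Proof. by apply/block_eqP => i _; rewrite iter_shift addrAC. Qed.

Lemma nbhs_window N x : nbhs x [set y | window N y = window N x].
Proof.
have nbhsi (i : int) : nbhs x [set y : full_shift d | y i = x i].
  have /= := @proj_continuous int (fun=> discrete_topology 'I_d.+1) i x.
  by move=> /(_ [set x i]); apply; exact: discrete_set1.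
have nbhsM (M : nat) : nbhs x [set y : full_shift d |
    forall k, (k < M)%N -> y (k%:Z - N%:Z) = x (k%:Z - N%:Z)].
  elim: M => [|M IHM]; first exact: filterE.
  apply: filterS2 IHM (nbhsi (M%:Z - N%:Z)) => y ltM eqM k.
  by rewrite ltnS leq_eqVlt => /predU1P[->//|]; exact: ltM.
apply: filterS (nbhsM N.*2.+1) => y yx; apply/window_eqP => i leiN.
by have := yx (absz (i + N%:Z)); rewrite (_ : _ - _ = i); [apply|]; lia.
Qed.

Lemma nbhs_windowP x (B : set (full_shift d)) : nbhs x B <->
  exists N, forall y, window N y = window N x -> B y.
Proof.
split=> [nB|[N NB]]; last by apply: filterS (nbhs_window N x).
(* The filter generated by the window sets converges to [x] in every coordinate, hence in the
   product topology, which is the supremum of the coordinate topologies. *)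
pose F : set_system (full_shift d) :=
  filter_from setT (fun N => [set y | window N y = window N x]).
have FF : Filter F.
  apply: filter_from_filter; first by exists 0%N.
  move=> N M _ _; exists (maxn N M) => // y /window_eqP e.
  by split; apply/window_eqP => i ?; apply: e; lia.
have Fx : F --> x.
  apply/cvg_sup => i; apply/cvg_image.
    by rewrite predeqE => a; split=> // _; exists (fun=> a).
  move=> B' /nbhs_singleton B'x.
  exists [set y : full_shift d | B' (y i)].
    exists `|i|%N => // y /window_eqP yx; rewrite /= yx//.
  rewrite eqEsubset; split=> [_ [y + <-]//|a B'a].
  by exists (fun=> a).
have [N _ NB] := Fx _ nB; by exists N.
Qed.

Lemma full_shift_compact : compact [set: full_shift d].
Proof.
have finI : finite_set [set: discrete_topology 'I_d.+1].
  exact: (@finite_finset 'I_d.+1).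
have := @tychonoff int (fun=> discrete_topology 'I_d.+1) (fun=> setT)
  (fun=> finite_compact finI).
by congr compact; rewrite eqEsubset.
Qed.


(** Compactness in near-covering form. It yields the uniform continuity and boundedness of
    potentials and, later, the finite subcover behind countable additivity of the limit measure. *)
Lemma full_shift_near (P : nat -> full_shift d -> Prop) :
  (forall x, exists N, forall y n, (N <= n)%N -> window N y = window N x -> P n y) ->
  exists N, forall n x, (N <= n)%N -> P n x.
Proof.
move=> locP.
have nP x : [set: full_shift d] x -> \forall x' \near x & i \near \oo, P i x'.
  move=> _; have [N NP] := locP x.
  exists ([set y | window N y = window N x], [set n | (N <= n)%N]).
    by split; [exact: nbhs_window|exists N].
  by move=> [y n] /= [? ?]; exact: NP.
have /compact_near_coveringP/(_ nat \oo P _ nP)[N _ NP] := full_shift_compact.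
by exists N => n x /NP; exact.
Qed.

Section potential.
Context {R : realType} (phi : full_shift d -> R) (hphi : continuous phi).

Lemma uniform_window (e : R) : 0 < e -> exists N, forall n x y, (N <= n)%N ->
  window n x = window n y -> `|phi x - phi y| < e.
Proof.
move=> e0.
have [|N NP] := @full_shift_near (fun n x => forall y,
    window n x = window n y -> `|phi x - phi y| < e); last first.
  by exists N => n x y leNn; exact: NP.
move=> x; have e20 : 0 < e / 2 by rewrite divr_gt0.
have /nbhs_windowP[N NP] : nbhs x [set y | `|phi x - phi y| < e / 2].
  by have /cvgrPdist_lt := @hphi x; apply.
exists N => y n leNn yx z yz.
have /NP /= zx : window N z = window N x.
  rewrite -yx; apply/window_eqP => i leiN; apply/esym.
  by move/window_eqP : yz; apply; exact: leq_trans leNn.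
have /NP /= := yx; move: zx; set a := phi x; set b := phi y; set c := phi z.
rewrite !ltr_norml; lra.
Qed.

Lemma potential_bounded : exists B, forall x, `|phi x| <= B.
Proof.
have [|N NP] := @full_shift_near (fun n x => `|phi x| <= n%:R); last first.
  by exists N%:R => x; exact: NP.
move=> x.
have /nbhs_windowP[N NP] : nbhs x [set y | `|phi x - phi y| < 1].
  by have /cvgrPdist_lt := @hphi x; apply.
exists (maxn N (Num.truncn (`|phi x| + 1)).+1) => y n.
rewrite geq_max => /andP[leNn len] /window_eqP yx.
have /NP /= : window N y = window N x.
  by apply/window_eqP => i leiN; apply: yx; lia.
move=> yx1; apply: le_trans (_ : (Num.truncn (`|phi x| + 1)).+1%:R <= _); last first.
  by rewrite ler_nat.
apply/ltW/(le_lt_trans _ (truncnS_gt _)).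
rewrite -[phi y](subrK (phi x)) addrC (le_trans (ler_normD _ _))// lerD2l.
by rewrite distrC ltW.
Qed.

End potential.
End topology.

(** * Approximation by shift spaces with few words *)

Section shift_spaces.
Context {d : nat}.
Implicit Types (x y : full_shift d) (X S : set (full_shift d)).

Definition translate (k : int) x : full_shift d := fun i => x (i + k).

Lemma block_translate k x m n : block (translate k x) m n = block x (m + k) n.
Proof. by apply/block_eqP => i _; rewrite /translate addrAC. Qed.

(** Forward translations use one inclusion of the equality f(X) = X; backward ones use the other,
    together with the injectivity of the shift. *)
Lemma shift_space_translate X k x : shift_space X -> X x -> X (translate k x).
Proof.
move=> [_ _ fX]; case: k => k.
  elim: k => [|k IHk] Xx.
    by rewrite (_ : translate _ _ = x)//; apply/funext => i; rewrite /translate addr0.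
  rewrite -fX; exists (translate k x); first exact: IHk.
  by apply/funext => i; rewrite /shift /translate; congr x; lia.
elim: k => [|k IHk] Xx.
  move: Xx; rewrite -{1}fX => -[y Xy <-].
  rewrite (_ : translate _ _ = y)//; apply/funext => i.
  by rewrite /translate /shift; congr y; lia.
have := IHk Xx; rewrite -{1}fX => -[y Xy yx].
rewrite (_ : translate _ _ = y)//; apply/funext => i.
have := congr1 (fun z => z (i - 1)) yx; rewrite /shift /translate => e.
by rewrite (_ : i + _ = i - 1 + Negz k) ?subrK//; [rewrite -e subrK|lia].
Qed.

Lemma shift_space_iter X k x : shift_space X -> X x -> X (iter k (@shift d) x).
Proof.
move=> sX Xx; rewrite (_ : iter _ _ _ = translate k x).
  exact: shift_space_translate.
by apply/funext => i; rewrite iter_shift.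
Qed.

Lemma languageP X n (w : n.-tuple 'I_d.+1) (m : int) : shift_space X ->
  language X n w <-> exists2 x, X x & block x m n = w.
Proof.
move=> sX; split=> [[x Xx [k <-]]|[x Xx <-]]; last by exists x => //; exists m.
exists (translate (k - m) x); first exact: shift_space_translate.
by rewrite block_translate addrC subrK.
Qed.

(* The smallest shift space containing [S]. *)
Definition hull S : set (full_shift d) :=
  [set y | forall m n, language S n (block y m n)].

Lemma sub_hull S : S `<=` hull S.
Proof. by move=> x Sx m n; exists x => //; exists m. Qed.

Lemma hull_translate S k x : hull S x -> hull S (translate k x).
Proof. by move=> Sx m n; rewrite block_translate. Qed.

Lemma shift_space_hull S : S !=set0 -> shift_space (hull S).
Proof.
move=> [x Sx]; split.
- by exists x; exact: sub_hull.
- rewrite -openC openE => y /= nSy; apply/nbhs_windowP.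
  have /existsNP[m /existsNP[n mnS]] := nSy.
  exists (absz m + n)%N => z /window_eqP zy Sz; apply: mnS.
  rewrite (_ : block y m n = block z m n)//; apply/esym/block_eqP => i ltin.
  by apply: zy; lia.
- rewrite eqEsubset; split=> [_ [y Sy <-]|y Sy].
    exact: (hull_translate 1).
  exists (translate (- 1) y); first exact: hull_translate.
  by apply/funext => i; rewrite /shift /translate addrK.
Qed.

Lemma language_hull S n : language (hull S) n = language S n.
Proof.
rewrite eqEsubset; split=> [w [x Sx [m <-]]|w [x Sx mw]]; first exact: Sx.
by exists x => //; exact: sub_hull.
Qed.

Lemma language_prefix X Y n m : (m <= n)%N ->
  language X n `<=` language Y n -> language X m `<=` language Y m.
Proof.
move=> lemn XY _ [x Xx [k <-]].
have [|y Yy [j /block_eqP e]] := XY (block x k n).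
  by exists x => //; exists k.
exists y => //; exists j; apply/block_eqP => i ltim.
by apply: e; exact: leq_trans lemn.
Qed.

(** * Points spelled by paths of a Rauzy graph *)

Section approximants.
Variables (l : nat) (X : set (full_shift d)).
Hypothesis sX : shift_space X.
Let word : finType := (l.*2.+1).-tuple 'I_d.+1.
Implicit Types v w : word.

(** Edge relation of the Rauzy graph, whose vertices are the words of length 2l+1. *)
Definition overlap v w := forall j, (j < l.*2)%N -> nth ord0 w j = nth ord0 v j.+1.

Lemma nth_block x m n i : (i < n)%N -> nth ord0 (block x m n) i = x (m + i%:Z).
Proof. by move=> ltin; rewrite (nth_mktuple _ _ (Ordinal ltin)). Qed.

Lemma overlap_block x m : overlap (block x m l.*2.+1) (block x (m + 1) l.*2.+1).
Proof. by move=> j ltj; rewrite !nth_block//; [congr x|]; lia. Qed.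

(** Keeping a single outgoing edge per vertex destroys the entropy: a forward path is determined by
    its first vertex. *)
Lemma successor_exists : exists s : word -> word,
  forall w, language X _ w -> language X _ (s w) /\ overlap w (s w).
Proof.
suff /choice[f fP] : forall w, exists v,
    language X _ w -> language X _ v /\ overlap w v by exists f.
move=> w; have [[x Xx [m mw]]|nw] := pselect (language X _ w); last by exists w.
exists (block x (m + 1) l.*2.+1) => _; split; last by rewrite -mw; exact: overlap_block.
by exists x => //; exists (m + 1).
Qed.

Lemma predecessor_exists : exists p : word -> word,
  forall w, language X _ w -> language X _ (p w) /\ overlap (p w) w.
Proof.
suff /choice[f fP] : forall w, exists v,
    language X _ w -> language X _ v /\ overlap v w by exists f.
move=> w; have [[x Xx [m mw]]|nw] := pselect (language X _ w); last by exists w.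
exists (block x (m - 1) l.*2.+1) => _; split.
  by exists x => //; exists (m - 1).
by rewrite -mw -[in block x m](subrK 1 m); exact: overlap_block.
Qed.

Variables (s p : word -> word).
Hypothesis sP : forall w, language X _ w -> language X _ (s w) /\ overlap w (s w).
Hypothesis pP : forall w, language X _ w -> language X _ (p w) /\ overlap (p w) w.

(** The path passes through [w] at time 0 and follows [s] forwards and [p] backwards. Since [Negz n]
    is -(n+1), it receives [n.+1] backward steps. *)
Definition rauzy_path w (i : int) : word :=
  match i with Posz n => iter n s w | Negz n => iter n.+1 p w end.

Definition rauzy_point w : full_shift d := fun i => nth ord0 (rauzy_path w i) 0.

Lemma rauzy_path_language w i : language X _ w -> language X _ (rauzy_path w i).
Proof.
by move=> Xw; case: i => n; elim: n => [|n IHn] //=; (apply sP || apply pP).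
Qed.

Lemma rauzy_path_overlap w i : language X _ w ->
  overlap (rauzy_path w i) (rauzy_path w (i + 1)).
Proof.
move=> Xw; case: i => n.
  by rewrite -PoszD addn1; apply: (sP _).2; exact: (@rauzy_path_language w n).
have -> : rauzy_path w (Negz n + 1) = iter n p w.
  by case: n => [|n]//; rewrite (_ : _ + 1 = Negz n)//; lia.
rewrite /=; apply pP; elim: n => [|n IHn]//=; exact: (pP IHn).1.
Qed.

Lemma rauzy_point_block w i : language X _ w ->
  block (rauzy_point w) i l.*2.+1 = rauzy_path w i.
Proof.
move=> Xw; apply: eq_from_tnth => j; rewrite tnth_mktuple (tnth_nth ord0).
have: (j < l.*2.+1)%N by [].
elim: (nat_of_ord j) i => {j} [|j IHj] i ltj; first by rewrite addr0.
rewrite -(rauzy_path_overlap i Xw)//.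
by rewrite -IHj ?(ltnW ltj)//; congr (rauzy_point w); lia.
Qed.

Definition rauzy_points := [set rauzy_point w | w in language X l.*2.+1].

Lemma rauzy_language n : (n <= l.*2.+1)%N -> language rauzy_points n = language X n.
Proof.
move=> len; rewrite eqEsubset; split; apply: language_prefix len _.
  move=> _ [_ [w Xw <-] [k <-]]; rewrite rauzy_point_block//.
  exact: rauzy_path_language.
move=> w Xw; exists (rauzy_point w); first by exists w.
by exists 0; rewrite rauzy_point_block.
Qed.

(** The choices [s] and [p] need not be inverse to each other, so a path restarted at time [i]
    retraces the original one only in the direction away from time 0; hence the sign condition. *)
Lemma rauzy_pathD w (i j : int) : 0 <= i * j ->
  rauzy_path w (i + j) = rauzy_path (rauzy_path w i) j.
Proof.
case: i => m; case: j => n ij.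
- by rewrite addrC; exact: iterD.
- by rewrite (_ : m = 0%N) ?add0r//; nia.
- by rewrite (_ : n = 0%N) ?addr0//; nia.
- by rewrite (_ : Negz m + Negz n = Negz (n + m.+1)); [exact: (iterD n.+1 m.+1)|lia].
Qed.

Lemma rauzy_pointD w (i j : int) : 0 <= i * j ->
  rauzy_point w (i + j) = rauzy_point (rauzy_path w i) j.
Proof. by rewrite /rauzy_point => ij; rewrite rauzy_pathD. Qed.

(* A block of a Rauzy point is read off a forward path, a backward path, or both
   glued at some place of the block. *)
Lemma rauzy_card n :
  (#|[pred w | w \in language rauzy_points n]| <= #|word| * n.+1)%N.
Proof.
(* The index [vc.2] counts the letters of the block that precede time 0: none for a block of the
   forward part, all [n] for a block of the backward part, which is restarted at its right end. *)
pose h (vc : word * 'I_n.+1) : n.-tuple 'I_d.+1 :=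
  block (rauzy_point vc.1) (- (vc.2 : nat)%:Z) n.
have subh : {subset [pred w | w \in language rauzy_points n] <= codom h}.
  move=> w; rewrite inE => -[_ [v Xv <-] [k <-]].
  have [k0|k0] := leP 0 k.
    apply/codomP; exists (rauzy_path v k, ord0); apply/block_eqP => i ltin.
    by rewrite rauzy_pointD; [congr (rauzy_point _ _) => /=; lia|nia].
  have [kn|kn] := leP k (- n%:Z).
    apply/codomP; exists (rauzy_path v (k + n%:Z), ord_max); apply/block_eqP => i ltin.
    rewrite (_ : k + i = (k + n%:Z) + (- n%:Z + i%:Z)); last by lia.
    by rewrite rauzy_pointD//; nia.
  have ltk : (absz k < n.+1)%N by lia.
  apply/codomP; exists (v, Ordinal ltk); apply/block_eqP => i ltin.
  by congr (rauzy_point _ _) => /=; lia.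
have /fintype.subsetP/subset_leq_card/leq_trans-> // := subh.
by rewrite (leq_trans (leq_image_card _ _))// cardE -cardT card_prod card_ord.
Qed.

End approximants.

Lemma approximant_exists l X : shift_space X -> exists Y, [/\ shift_space Y,
  (forall n, (n <= l.*2.+1)%N -> language Y n = language X n) &
  exists C, forall n, (#|[pred w | w \in language Y n]| <= C * n.+1)%N].
Proof.
move=> sX; have [s sP] := successor_exists l X; have [p pP] := predecessor_exists l X.
exists (hull (rauzy_points X s p)); split.
- apply: shift_space_hull; case: sX => -[x Xx] _ _.
  exists (rauzy_point s p (block x 0 l.*2.+1)); exists (block x 0 l.*2.+1) => //.
  by exists x => //; exists 0.
- by move=> n len; rewrite language_hull; exact: rauzy_language.
- by eexists => n; rewrite language_hull; exact: rauzy_card.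
Qed.

(** Sample point at which a potential is evaluated to become a function of windows. Its letters
    outside the window are arbitrary, and it need not lie in the shift space at hand. *)
Definition word_point N (w : (N.*2.+1).-tuple 'I_d.+1) : full_shift d :=
  fun i => nth ord0 w (absz (i + N%:Z)).

Lemma window_word_point N w : window N (word_point w) = w.
Proof.
apply: eq_from_tnth => i; rewrite tnth_mktuple (tnth_nth ord0) /word_point.
by congr (nth _ _ _); lia.
Qed.

Definition shift_oracle_of X n : seq ((n.*2.+1).-tuple 'I_d.+1) :=
  enum [pred w | w \in language X n.*2.+1].

Lemma shift_oracle_ofP X : shift_oracle X (shift_oracle_of X).
Proof.
move=> n; split=> [|w]; first exact: enum_uniq.
by rewrite mem_enum inE.
Qed.

(** Computability speaks about given oracles, so it has content only if some oracle exists; one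
    arises by sampling the potential on windows and rounding to rationals. *)
Lemma potential_oracle_exists {R : realType} (phi : full_shift d -> R) :
  continuous phi -> exists O, potential_oracle phi O.
Proof.
move=> hphi; suff /choice[chi chiP] : forall n : nat, exists chi : loc_const d,
    sup_norm (fun x => ratr (loc_const_eval chi x) - phi x) < 2 ^- n by exists chi.
(* Oscillation over a window and rounding cost [e] each. The total [2 ^- n.+1] leaves room for a
   strict inequality after passing to the supremum. *)
move=> n; pose e : R := 2 ^- n.+2.
have e0 : 0 < e by rewrite invr_gt0 exprn_gt0.
have [N NP] := uniform_window hphi e0.
have /choice[q qP] : forall w : (N.*2.+1).-tuple 'I_d.+1, exists q : rat,
    `|ratr q - phi (word_point w)| < e.
  move=> w; have [|q] := @rat_in_itvoo R (phi (word_point w) - e) (phi (word_point w) + e).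
    lra.
  by rewrite in_itv/= => /andP[? ?]; exists q; rewrite ltr_norml; lra.
exists (existT _ N [ffun w => q w]).
apply: (@le_lt_trans _ _ (e + e)).
  apply: ge_sup.
    exists `|ratr (loc_const_eval (existT _ N [ffun w => q w]) point) - phi point|.
    by exists point.
  move=> _ [x _ <-]; rewrite /loc_const_eval/= ffunE -/(window N x).
  have := qP (window N x).
  have := NP N x (word_point (window N x)) (leqnn _) (esym (window_word_point _)).
  rewrite !ltr_norml ler_norml; lra.
rewrite /e !exprSr !invfM; have : 0 < (2 ^- n : R) by rewrite invr_gt0 exprn_gt0.
set t := _^-1; lra.
Qed.

End shift_spaces.

(** * Pressure *)

(** Fekete's subadditive lemma, the limit being the infimum. The bound at each finite [n] is
    recorded too, since the pressure is later compared with a single partition sum. *)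
Lemma fekete {R : realType} (u : nat -> R) (B : R) :
  (forall m n, u (m + n)%N <= u m + u n) -> (forall n, - (n%:R * B) <= u n) ->
  exists l : R, (fun n => n%:R^-1 * u n) @ \oo --> l /\
    forall n, (0 < n)%N -> l <= n%:R^-1 * u n.
Proof.
move=> uD uB; pose S := [set n%:R^-1 * u n | n in [set n | (0 < n)%N]].
have S1 : S (1%:R^-1 * u 1%N) by exists 1%N.
have Slb : lbound S (- B).
  move=> _ [n /= n0 <-]; rewrite -(ler_pM2l (x := n%:R)) ?ltr0n// mulrA.
  by rewrite divff ?pnatr_eq0 -?lt0n// mul1r mulrN.
have infS : has_inf S by split; [exists (1%:R^-1 * u 1%N)|exists (- B)].
have le_inf n : (0 < n)%N -> inf S <= n%:R^-1 * u n.
  by move=> n0; apply: ge_inf; [exists (- B)|exists n].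
exists (inf S); split=> //.
apply/cvgrPdist_le => e e0; have e20 : 0 < e / 2 by rewrite divr_gt0.
have [_ [m /= m0 <-] um] := inf_adherent e20 infS.
have uM q : u (q * m)%N <= q%:R * u m + u 0%N.
  elim: q => [|q IHq]; first by rewrite mul0n mul0r add0r.
  by rewrite mulSn (le_trans (uD _ _))// mulrS mulrDl mul1r -addrA lerD2l.
(* For n = q m + r, the three summands pay for [u r], for replacing q m by n in the slope of [u m],
   and for the term [u 0] in [uM]. *)
pose C := \sum_(r < m) `|u r| + `|u m| + u 0%N : R.
have uC n : (0 < n)%N -> n%:R^-1 * u n <= m%:R^-1 * u m + n%:R^-1 * C.
  move=> n0; have nR0 : 0 < n%:R :> R by rewrite ltr0n.
  rewrite -(ler_pM2l nR0) mulrDr !mulrA divff ?gt_eqF// !mul1r.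
  set a := m%:R^-1 * u m; rewrite -mulrA -/a.
  have um_a : u m = m%:R * a by rewrite mulrA divff ?mul1r// pnatr_eq0 -lt0n.
  clearbody a.
  have nR : n%:R = (n %/ m)%:R * m%:R + (n %% m)%:R :> R.
    by rewrite -natrM -natrD -divn_eq.
  have ltr : (n %% m)%:R * `|a| <= `|u m|.
    by rewrite um_a normrM [`|m%:R|]ger0_norm// ler_wpM2r// ler_nat ltnW// ltn_mod.
  have ur : u (n %% m)%N <= \sum_(r < m) `|u r|.
    rewrite (bigD1 (Ordinal (ltn_pmod n m0)))//= (le_trans (ler_norm _))//.
    by rewrite lerDl sumr_ge0.
  have := uD ((n %/ m) * m)%N (n %% m)%N; rewrite -divn_eq => un.
  have := uM (n %/ m)%N; rewrite um_a => uq.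
  have : - ((n %% m)%:R * a) <= (n %% m)%:R * `|a|.
    by rewrite -mulrN ler_wpM2l// -normrN ler_norm.
  rewrite nR mulrDl -mulrA /C; lra.
exists (Num.truncn (2 * C / e)).+1 => //= n ltn.
have n0 : (0 < n)%N by exact: leq_trans ltn.
have nR0 : 0 < n%:R :> R by rewrite ltr0n.
have Cn : n%:R^-1 * C <= e / 2.
  rewrite -(ler_pM2l nR0) mulrA divff ?gt_eqF// mul1r.
  have : 2 * C / e <= n%:R.
    by rewrite (le_trans (ltW (truncnS_gt _)))// ler_nat.
  by rewrite ler_pdivrMr//; lra.
have := le_inf _ n0; have := uC _ n0; rewrite ler_norml; lra.
Qed.

Section pressure_theory.
Context {R : realType} {d : nat} (phi : full_shift d -> R) (B : R).
Hypothesis phiB : forall x, `|phi x| <= B.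
Implicit Types X : set (full_shift d).

Lemma birkhoff_sumD m n x : birkhoff_sum phi (m + n) x =
  birkhoff_sum phi m x + birkhoff_sum phi n (iter m (@shift d) x).
Proof.
rewrite /birkhoff_sum big_split_ord/=; congr (_ + _).
by apply: eq_bigr => k _; rewrite -iterD addnC.
Qed.

Lemma birkhoff_sum_bound n x : `|birkhoff_sum phi n x| <= n%:R * B.
Proof.
rewrite (le_trans (ler_norm_sum _ _ _))// (le_trans (ler_sum _ (fun k _ => phiB _)))//.
by rewrite sumr_const card_ord mulr_natl.
Qed.

Definition cylinder_sup X n (w : n.-tuple 'I_d.+1) : R :=
  sup [set birkhoff_sum phi n x | x in cylinder X w].

Definition partition_sum X n : R :=
  \sum_(w : n.-tuple 'I_d.+1 | w \in language X n) expR (cylinder_sup X w).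

Lemma birkhoff_le_cylinder_sup X n x : X x ->
  birkhoff_sum phi n x <= cylinder_sup X (block x 0 n).
Proof.
move=> Xx; apply: ub_le_sup; last by exists x.
exists (n%:R * B) => _ [y _ <-].
exact: le_trans (ler_norm _) (birkhoff_sum_bound _ _).
Qed.

Section fixed_space.
Variable X : set (full_shift d).
Hypothesis sX : shift_space X.

Lemma cylinder_nonempty n (w : n.-tuple 'I_d.+1) :
  language X n w -> cylinder X w !=set0.
Proof. by move/(languageP _ 0 sX) => [x Xx xw]; exists x. Qed.

Lemma cylinder_sup_le n (w : n.-tuple 'I_d.+1) (c : R) : language X n w ->
  (forall x, X x -> block x 0 n = w -> birkhoff_sum phi n x <= c) ->
  cylinder_sup X w <= c.
Proof.
move=> /cylinder_nonempty[x [Xx xw]] le_c; apply: ge_sup.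
  by exists (birkhoff_sum phi n x); exists x.
by move=> _ [y [Xy yw] <-]; exact: le_c.
Qed.

Lemma partition_sum_ge n : expR (- (n%:R * B)) <= partition_sum X n.
Proof.
have [[x Xx] _ _] := sX.
have Lx : block x 0 n \in language X n.
  by apply/mem_set; exists x => //; exists 0.
rewrite /partition_sum (bigD1 _ Lx)/= ler_wpDr//.
  by apply: sumr_ge0 => w _; exact: expR_ge0.
rewrite ler_expR (le_trans _ (birkhoff_le_cylinder_sup _ Xx))//.
by have := birkhoff_sum_bound n x; rewrite ler_norml => /andP[].
Qed.

Lemma partition_sum_gt0 n : 0 < partition_sum X n.
Proof. exact: lt_le_trans (expR_gt0 _) (partition_sum_ge n). Qed.

(** Cutting a word after [m] letters is injective and maps words of [X] to pairs of words of [X],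
    and Birkhoff sums split accordingly. Pairs that are not obtained in this way only add
    nonnegative terms on the right. *)
Lemma partition_sumM m n :
  partition_sum X (m + n) <= partition_sum X m * partition_sum X n.
Proof.
pose h (w : (m + n).-tuple 'I_d.+1) : m.-tuple 'I_d.+1 * n.-tuple 'I_d.+1 :=
  ([tuple tnth w (lshift n i) | i < m], [tuple tnth w (rshift m i) | i < n]).
pose F u v := expR (@cylinder_sup X m u) * expR (@cylinder_sup X n v).
pose G p := (if (p.1 \in language X m) && (p.2 \in language X n) then F p.1 p.2 else 0).
have G0 p : 0 <= G p by rewrite /G; case: ifP => // _; rewrite mulr_ge0 ?expR_ge0.
have hblock x k : h (block x k (m + n)) = (block x k m, block x (k + m%:Z) n).
  rewrite /h; congr pair; apply: eq_from_tnth => i; rewrite !tnth_mktuple//.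
  by congr (x _); rewrite /=; lia.
have hinj : injective h.
  move=> w w' ew; have e1 := congr1 fst ew; have e2 := congr1 snd ew; apply: eq_from_tnth => i.
  rewrite -(splitK i); case: (fintype.split i) => j /=.
    by have := congr1 (fun t => tnth t j) e1; rewrite !tnth_mktuple.
  by have := congr1 (fun t => tnth t j) e2; rewrite !tnth_mktuple.
have le_G w : w \in language X (m + n) -> expR (cylinder_sup X w) <= G (h w).
  move=> /set_mem Xw; have [x Xx xw] := (languageP w 0 sX).1 Xw.
  have Xmx := shift_space_iter m sX Xx.
  rewrite /G -xw hblock/= !mem_set/=; [|by exists x => //; eexists..].
  rewrite /F -expRD ler_expR; apply: cylinder_sup_le; first by exists x => //; exists 0.
  move=> y Xy /(congr1 h); rewrite !hblock !add0r => e.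
  have /= <- := congr1 fst e; have /= <- := congr1 snd e.
  rewrite birkhoff_sumD lerD ?birkhoff_le_cylinder_sup//.
  have := birkhoff_le_cylinder_sup n (shift_space_iter m sX Xy).
  by rewrite block_iter_shift add0r.
rewrite {1}/partition_sum (le_trans (ler_sum _ le_G))//.
apply: (@le_trans _ _ (\sum_w G (h w))).
  by rewrite [leRHS](bigID (fun w => w \in language X (m + n)))/= lerDl sumr_ge0.
have <- : \sum_(p in h @: finset.setT) G p = \sum_w G (h w).
  rewrite big_imset/=; last by move=> ? ? _ _; exact: hinj.
  by apply: eq_bigl => w; rewrite inE.
apply: (@le_trans _ _ (\sum_p G p)).
  by rewrite [leRHS](bigID (fun p => p \in h @: finset.setT))/= lerDl sumr_ge0.
rewrite /partition_sum big_distrlr/= pair_big/= le_eqVlt; apply/orP; left.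
by rewrite /G -big_mkcond.
Qed.

Lemma pressure_cvg :
  (fun n => n%:R^-1 * ln (partition_sum X n)) @ \oo --> pressure X phi /\
  forall n, (0 < n)%N -> pressure X phi <= n%:R^-1 * ln (partition_sum X n).
Proof.
have [|n|l [cvl le_l]] := @fekete R (fun n => ln (partition_sum X n)) B.
- move=> m n; rewrite -lnM ?posrE ?partition_sum_gt0//.
  by rewrite ler_ln ?posrE ?mulr_gt0 ?partition_sum_gt0// partition_sumM.
- by rewrite -[leLHS]expRK ler_ln ?posrE ?expR_gt0 ?partition_sum_gt0// partition_sum_ge.
- have -> : pressure X phi = l by apply/cvg_lim.
  by [].
Qed.

(* With only linearly many words, the number of terms of the partition sum does not
   contribute to the pressure. *)
Lemma good_orbit_segment (C : nat) (e : R) n0 :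
  (forall n, (#|[pred w | w \in language X n]| <= C * n.+1)%N) -> 0 < e ->
  exists n x, [/\ (n0 < n)%N, X x & pressure X phi - e <= n%:R^-1 * birkhoff_sum phi n x].
Proof.
move=> cardX e0; apply: contrapT => noorbit.
(* If all segments of length n fell short, exp(n e) <= C (n + 1) would follow. But exp(n e) >= (n e
   / 2)^2 > 2 C n >= C (n + 1) as soon as 8 C < n e^2. *)
pose n := (maxn n0 (Num.truncn (8 * C%:R / e ^+ 2))).+1.
have n0n : (n0 < n)%N by rewrite ltnS leq_maxl.
have n_gt0 : 0 < n%:R :> R by rewrite ltr0n.
have small x : X x -> birkhoff_sum phi n x <= n%:R * (pressure X phi - e).
  move=> Xx; rewrite leNgt; apply/negP => lt_x; apply: noorbit.
  by exists n, x; split=> //; rewrite -(ler_pM2l n_gt0) mulrA divff ?gt_eqF// mul1r ltW.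
have : partition_sum X n <= (C * n.+1)%:R * expR (n%:R * (pressure X phi - e)).
  apply: (@le_trans _ _ (\sum_(w : n.-tuple 'I_d.+1 | w \in language X n)
      expR (n%:R * (pressure X phi - e)))).
    apply: ler_sum => w /set_mem Xw; rewrite ler_expR.
    by apply: cylinder_sup_le => // x Xx _; exact: small.
  rewrite sumr_const -[leLHS]mulr_natl ler_wpM2r ?expR_ge0// ler_nat.
  exact: cardX.
have := pressure_cvg.2 n isT.
rewrite -(ler_pM2l n_gt0) mulrA divff ?gt_eqF// mul1r.
move=> le1 le2.
have : expR (n%:R * pressure X phi) <= partition_sum X n.
  by rewrite -[leRHS]lnK ?posrE ?partition_sum_gt0// ler_expR.
move=> /le_trans/(_ le2); rewrite mulrBr expRD expRN mulrCA -[leLHS]mulr1.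
rewrite ler_pM2l ?expR_gt0// ler_pdivlMr ?expR_gt0// mul1r.
have nlarge : 8 * C%:R < n%:R * e ^+ 2.
  rewrite -ltr_pdivrMr ?exprn_gt0//; apply: lt_le_trans (truncnS_gt _) _.
  by rewrite ler_nat ltnS leq_maxr.
have ne0 : 0 <= n%:R * e / 2 by rewrite !mulr_ge0// ltW.
have : (n%:R * e / 2) ^+ 2 <= expR (n%:R * e).
  rewrite [in leRHS](_ : n%:R * e = 2%:R * (n%:R * e / 2)); last by field.
  rewrite expRM_natl lerXn2r ?nnegrE ?expR_ge0//.
  by apply: le_trans (expR_ge1Dx _); lra.
have : C%:R * n.+1%:R <= 2 * C%:R * n%:R :> R.
  by rewrite -mulrA mulrCA ler_wpM2l// -natrM ler_nat; lia.
have : n%:R * (8 * C%:R) < n%:R * (n%:R * e ^+ 2) by rewrite ltr_pM2l.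
rewrite natrM expr2; nra.
Qed.

End fixed_space.
End pressure_theory.

(** * Limits of orbit segments *)

(** Compactness of the segment gives a cluster point, and an ultrafilter converges to each of its
    cluster points. *)
Lemma ultra_bounded_cvg {R : realType} (U : set_system nat) (u : nat -> R) (B : R) :
  UltraFilter U -> (forall n, `|u n| <= B) -> cvg (u @ U).
Proof.
move=> UU uB; have PU : ProperFilter U := @ultra_proper _ _ UU.
have := @segment_compact R (- B) B.
move=> /(_ (u @ U) _)[|l [_ cl]].
  by apply: (@filterE _ U) => n /=; rewrite in_itv/= -ler_norml uB.
apply/cvg_ex; exists l => V Vl.
have [//|nV] := in_ultra_setVsetC (u @^-1` V) UU.
by have [z [nVz Vz]] := cl (~` V) V nV Vl.
Qed.

(** * The algebra of clopen sets *)

Section local_sets.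
Context {d : nat}.
Implicit Types A B : set (full_shift d).

(** By compactness these are exactly the clopen sets, that is, the finite unions of cylinders. *)
Definition local_set A : Prop :=
  exists N, forall x y, window N x = window N y -> A x -> A y.

Lemma window_mono M N (x y : full_shift d) : (M <= N)%N ->
  window N x = window N y -> window M x = window M y.
Proof.
move=> leMN /window_eqP e; apply/window_eqP => i leiM.
by apply: e; exact: leq_trans leMN.
Qed.

Lemma local_set0 : local_set set0. Proof. by exists 0%N. Qed.

Lemma local_setC A : local_set A -> local_set (~` A).
Proof. by move=> [N NA]; exists N => x y xy + Ay; apply; exact: NA Ay. Qed.

Lemma local_setU A B : local_set A -> local_set B -> local_set (A `|` B).
Proof.
move=> [N NA] [M MB]; exists (maxn N M) => x y xy [Ax|Bx].
  by left; apply: NA Ax; apply: window_mono xy; exact: leq_maxl.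
by right; apply: MB Bx; apply: window_mono xy; exact: leq_maxr.
Qed.

Lemma local_setI A B : local_set A -> local_set B -> local_set (A `&` B).
Proof.
move=> lA lB; rewrite -[A `&` B]setCK setCI.
by apply/local_setC/local_setU; exact: local_setC.
Qed.

Lemma local_set_window N (P : set ((N.*2.+1).-tuple 'I_d.+1)) :
  local_set (window N @^-1` P).
Proof. by exists N => x y /= ->. Qed.

Lemma local_set_block m n (w : n.-tuple 'I_d.+1) :
  local_set [set x | block x m n = w].
Proof.
exists (absz m + n)%N => x y /window_eqP xy /= <-.
by apply/block_eqP => i ltin; apply/esym/xy; lia.
Qed.

Lemma local_set_shift A : local_set A -> local_set (@shift d @^-1` A).
Proof.
move=> [N NA]; exists N.+1 => x y /window_eqP xy; apply: NA.
by apply/window_eqP => i leiN; apply: xy; lia.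
Qed.

Lemma local_set_open A : local_set A -> open A.
Proof.
move=> [N NA]; rewrite openE => x Ax; apply/nbhs_windowP; exists N => y yx.
exact: NA Ax.
Qed.

Lemma local_set_measurable A :
  local_set A -> measurable (A : set (borel_shift d)).
Proof. by move/local_set_open => oA; exact: sub_sigma_algebra. Qed.

Lemma closed_measurable A :
  closed A -> measurable (A : set (borel_shift d)).
Proof.
move=> cA; rewrite -[A]setCK; apply: measurableC; apply: sub_sigma_algebra.
exact: closed_openC.
Qed.

Definition window_interior N A : set (full_shift d) :=
  [set x | forall y, window N y = window N x -> A y].

Lemma local_window_interior N A : local_set (window_interior N A).
Proof. by exists N => x y xy xA z zy; apply: xA; rewrite xy. Qed.

Lemma bigcup_window_interior A : open A -> A = \bigcup_N window_interior N A.
Proof.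
rewrite openE => oA; rewrite eqEsubset; split=> [x Ax|x [N _]]; last exact.
by have /nbhs_windowP[N NA] := oA _ Ax; exists N.
Qed.

End local_sets.

(* Alias of the full shift carrying the algebra of window-determined sets, from which
   the limit measure is extended. *)
Definition window_algebra (d : nat) : Type := full_shift d.
Definition window_display : measure_display. Proof. exact. Qed.

HB.instance Definition _ d := Pointed.on (window_algebra d).
HB.instance Definition _ d := @isAlgebraOfSets.Build window_display
  (window_algebra d) local_set local_set0 local_setU local_setC.

(** An open set is the countable union of its window interiors. Construction and uniqueness of Borel
    measures are thereby reduced to local sets. *)
Lemma borel_shift_measurableE d :
  @measurable _ (borel_shift d) = <<s (@local_set d) >>.
Proof.
rewrite eqEsubset; split.
  apply: smallest_sub; first exact: smallest_sigma_algebra.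
  move=> A /bigcup_window_interior ->.
  apply: sigma_algebra_bigcup => N; apply: sub_sigma_algebra.
  exact: local_window_interior.
apply: smallest_sub; first exact: sigma_algebra_measurable.
by move=> A; exact: local_set_measurable.
Qed.

(** * From finitely additive contents to Borel probabilities *)

Section extension.
Context {R : realType} {d : nat} (m : set (full_shift d) -> R).
Hypothesis m1 : m setT = 1.
Hypothesis m_ge0 : forall A, 0 <= m A.
Hypothesis mU : forall A B, A `&` B = set0 -> m (A `|` B) = m A + m B.

Let mE (A : set (window_algebra d)) : \bar R := (m A)%:E.

Let m0 : m set0 = 0.
Proof.
have := mU (setI0 set0); rewrite setU0 => /eqP.
by rewrite -subr_eq0 opprD addrA subrr add0r oppr_eq0 => /eqP.
Qed.

Let mE0 : mE set0 = 0%E. Proof. by rewrite /mE m0. Qed.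

Let mE_ge0 A : (0 <= mE A)%E. Proof. by rewrite lee_fin. Qed.

Let m_bigcup (F : nat -> set (full_shift d)) n : trivIset setT F ->
  m (\bigcup_(i in [set k | (k < n)%N]) F i) = \sum_(0 <= i < n) m (F i).
Proof.
move=> tF; elim: n => [|n IHn].
  by rewrite big_nil bigcup0//.
rewrite big_nat_recr//= -IHn -mU.
  congr m; rewrite eqEsubset; split=> [x [k /= ltk Fkx]|x [[k /= ltk Fkx]|Fnx]].
  - move: ltk; rewrite ltnS leq_eqVlt => /predU1P[<-|ltk]; first by right.
    by left; exists k.
  - by exists k => //=; exact: ltnW.
  - by exists n => /=.
rewrite -subset0 => x [[k /= ltk Fkx] Fnx].
have kn := tF k n I I (ex_intro _ x (conj Fkx Fnx)).
by rewrite kn ltnn in ltk.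
Qed.

(* By compactness a local set which is a countable union of disjoint local sets
   is the union of finitely many of them. *)
Let mE_sigma_additive : semi_sigma_additive mE.
Proof.
move=> F mF tF mUF; have [|N NP] := @full_shift_near d
    (fun n x => (\bigcup_i F i) x -> exists2 i, (i < n)%N & F i x).
  move=> x; have [[i _ Fix]|nFx] := pselect ((\bigcup_i F i) x).
    have [M MF] := mF i; exists (maxn i.+1 M) => y n; rewrite geq_max => /andP[ltin _] yx _.
    exists i => //; apply: MF Fix; apply/esym.
    by apply: window_mono yx; exact: leq_maxr.
  have [M MF] := mUF; exists M => y n _ yx /MF Fx.
  by exfalso; apply/nFx/Fx.
apply: cvg_near_cst; exists N => // n /= leNn.
rewrite /mE sumEFin -m_bigcup//; congr (m _)%:E; rewrite eqEsubset; split.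
  by move=> x [i _ Fix]; exists i.
by move=> x Fx; have [i] := NP _ _ leNn Fx; exists i.
Qed.

HB.instance Definition _ := isMeasure.Build _ _ _ mE mE0 mE_ge0 mE_sigma_additive.

Let ext : {measure set _ -> \bar R} :=
  measure_extension (mE : {measure set (window_algebra d) -> \bar R}).

Let borel_ext (A : set (borel_shift d)) : \bar R := ext A.

Let borel_ext0 : borel_ext set0 = 0%E. Proof. exact: measure0. Qed.

Let borel_ext_ge0 A : (0 <= borel_ext A)%E. Proof. exact: measure_ge0. Qed.

Let borel_ext_sigma_additive : semi_sigma_additive borel_ext.
Proof.
move=> F mF tF mUF; apply: (@measure_semi_sigma_additive _ _ _ ext) => //.
  by move=> i; have := mF i; rewrite borel_shift_measurableE.
by move: mUF; rewrite borel_shift_measurableE.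
Qed.

HB.instance Definition _ := isMeasure.Build _ _ _ borel_ext
  borel_ext0 borel_ext_ge0 borel_ext_sigma_additive.

Let borel_extE A : local_set A -> borel_ext A = (m A)%:E.
Proof. by move=> lA; rewrite /borel_ext /ext/= /measure_extension measurable_mu_extE. Qed.

Let borel_ext1 : borel_ext setT = 1%E.
Proof. by rewrite borel_extE ?m1//; exists 0%N. Qed.

HB.instance Definition _ := Measure_isProbability.Build _ _ _ borel_ext borel_ext1.

Lemma local_content_extension : exists mu : probability (borel_shift d) R,
  forall A, local_set A -> mu A = (m A)%:E.
Proof. by exists (borel_ext : probability (borel_shift d) R); exact: borel_extE. Qed.

End extension.

Lemma shift_measurable d :
  measurable_fun [set: borel_shift d] (@shift d : borel_shift d -> borel_shift d).
Proof.
apply: (@measurability _ _ (borel_shift d) (borel_shift d) setT (@shift d) (@local_set d)).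
  exact: borel_shift_measurableE.
move=> _ [A lA <-]; rewrite setTI; apply: local_set_measurable.
exact: local_set_shift.
Qed.

(** * Empirical measures and their ultrafilter limit *)

Section limit_measure.
Context {R : realType} {d : nat}.
Variables (x : nat -> full_shift d) (L : nat -> nat).
Hypothesis L_gt : forall n, (n < L n)%N.

Definition orbit_average (g : full_shift d -> R) n : R :=
  (L n)%:R^-1 * \sum_(k < L n) g (iter k (@shift d) (x n)).

Definition visit_frequency (A : set (full_shift d)) : nat -> R :=
  orbit_average (fun y => (y \in A)%:R).

Let L_gt0 n : 0 < (L n)%:R :> R. Proof. by rewrite ltr0n (leq_ltn_trans _ (L_gt n)). Qed.

Lemma orbit_average_le g h c n :
  (forall y, g y <= h y + c) -> orbit_average g n <= orbit_average h n + c.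
Proof.
move=> gh; rewrite -(ler_pM2l (L_gt0 n)) mulrDr !mulVKf ?gt_eqF//.
have -> : (L n)%:R * c = \sum_(k < L n) c by rewrite sumr_const card_ord mulr_natl.
by rewrite -big_split/= ler_sum.
Qed.

Lemma visit_frequency_ge0 A n : 0 <= visit_frequency A n.
Proof. by rewrite mulr_ge0 ?invr_ge0 ?sumr_ge0. Qed.

Lemma visit_frequencyT n : visit_frequency setT n = 1.
Proof.
rewrite /visit_frequency /orbit_average (eq_bigr (fun=> 1)).
  by rewrite sumr_const card_ord mulVf// gt_eqF.
by move=> k _; rewrite in_setT.
Qed.

Lemma visit_frequencyU A B n : A `&` B = set0 ->
  visit_frequency (A `|` B) n = visit_frequency A n + visit_frequency B n.
Proof.
move=> AB; rewrite -mulrDr -big_split/=; congr (_ * _); apply: eq_bigr => k _.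
set y := iter _ _ _; rewrite in_setU.
have [yA|yA] := boolP (y \in A); have [yB|yB] := boolP (y \in B); rewrite ?addr0 ?add0r//.
have : (A `&` B) y by split; exact: set_mem.
by rewrite AB.
Qed.

Lemma visit_frequency_le1 A n : visit_frequency A n <= 1.
Proof.
rewrite -(visit_frequencyT n) -(setUv A) visit_frequencyU ?setICr// lerDl.
exact: visit_frequency_ge0.
Qed.

(** The two counts telescope: they differ only at the ends of the orbit segment. *)
Lemma visit_frequency_shift A n :
  `|visit_frequency (@shift d @^-1` A) n - visit_frequency A n| <= (L n)%:R^-1.
Proof.
rewrite -mulrBr normrM gtr0_norm ?invr_gt0// -[leRHS]mulr1 ler_wpM2l ?invr_ge0 ?(ltW (L_gt0 n))//.
set F := fun k => (iter k (@shift d) (x n) \in A)%:R : R.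
rewrite (eq_bigr (fun k : 'I__ => F k.+1)); last by [].
rewrite -(big_mkord xpredT (fun k => F k.+1)) -(big_mkord xpredT F) -sumrB telescope_sumr//.
by rewrite /F ler_norml; case: (_ \in A); case: (_ \in A) => /=; lra.
Qed.

(** An ultrafilter makes all visit frequencies converge at once, so the limits are finitely
    additive. Invariance holds on local sets because the segments get longer, and extends to Borel
    sets because local sets are a generating family stable under intersection. *)
Lemma limit_measure_exists : exists (U : set_system nat)
    (mu : probability (borel_shift d) R),
  [/\ UltraFilter U, \oo `<=` U,
    (forall A, local_set A -> visit_frequency A @ U --> fine (mu A)) &
    forall A : set (borel_shift d), measurable A -> mu (@shift d @^-1` A) = mu A].
Proof.
have [U [UU ooU]] := @ultraFilterLemma nat \oo _.
have PU : ProperFilter U := @ultra_proper _ _ UU.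
have cvgf A : cvg (visit_frequency A @ U).
  apply: (@ultra_bounded_cvg _ _ _ 1) => n.
  by rewrite ger0_norm ?visit_frequency_ge0 ?visit_frequency_le1.
pose m A := lim (visit_frequency A @ U).
have mlim A l : visit_frequency A @ U --> l -> m A = l by move/cvg_lim; exact.
have [||A B AB|mu muE] := @local_content_extension R d m.
- apply: mlim; rewrite (_ : visit_frequency _ = cst 1); first exact: cvg_cst.
  by apply/funext => n; rewrite visit_frequencyT.
- by move=> A; apply: limr_ge => //; apply: filterE => n; exact: visit_frequency_ge0.
- apply: mlim; rewrite (_ : visit_frequency _ = visit_frequency A \+ visit_frequency B).
    by apply: cvgD; exact: cvgf.
  by apply/funext => n; rewrite visit_frequencyU.
exists U, mu; split=> //.
  by move=> A /muE ->; exact: cvgf.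
have mS : measurable_fun [set: borel_shift d] (@shift d : borel_shift d -> borel_shift d).
  exact: shift_measurable.
have shift_local A : local_set A -> mu (@shift d @^-1` A) = mu A.
  move=> lA; rewrite !muE//; last exact: local_set_shift.
  congr _%:E; apply: mlim.
  rewrite (_ : visit_frequency _ = (fun n => visit_frequency A n +
      (visit_frequency (@shift d @^-1` A) n - visit_frequency A n))); last first.
    by apply/funext => n; rewrite addrC subrK.
  rewrite -[m A]addr0; apply: cvgD; first exact: cvgf.
  apply: (@cvg_trans _ ((fun n =>
      visit_frequency (@shift d @^-1` A) n - visit_frequency A n) @ \oo)).
    by move=> V; exact: ooU.
  apply/cvgrPdist_le => e e0; exists (Num.truncn e^-1).+1 => // n /= ltn.
  rewrite sub0r normrN (le_trans (visit_frequency_shift _ _))//.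
  rewrite -[leRHS]invrK lef_pV2 ?posrE ?invr_gt0// (le_trans (ltW (truncnS_gt _)))//.
  by rewrite ler_nat ltnW// (leq_ltn_trans ltn)//.
move=> A mA; apply/esym.
apply: (@g_sigma_algebra_measure_unique _ R (borel_shift d) (@local_set d) _ (fun=> setT)
  _ _ mu (pushforward mu (@shift d : borel_shift d -> borel_shift d))).
- exact: local_set_measurable.
- by exists 0%N.
- by rewrite eqEsubset; split=> // z _; exists 0%N.
- exact: local_setI.
- by move=> B /shift_local.
- by move=> _; rewrite probability_setT ltry.
- by rewrite -borel_shift_measurableE.
Qed.

End limit_measure.

(** * Laws of finite-valued observables *)

(* Gibbs' inequality, combined with the monotonicity of the Shannon entropy under
   the factor map [h]. *)
Lemma gibbs_inequality {R : realType} (T U : finType) (h : T -> U)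
    (p q : T -> R) (ph : U -> R) :
  (forall t, 0 <= p t) -> \sum_t p t = 1 ->
  (forall t, 0 <= q t) -> \sum_t q t <= 1 -> (forall t, 0 < p t -> 0 < q t) ->
  (forall u, ph u = \sum_(t | h t == u) p t) ->
  - \sum_u ph u * ln (ph u) <= - \sum_t p t * ln (q t).
Proof.
move=> p0 p1 q0 q1 pq phE.
have -> : \sum_u ph u * ln (ph u) = \sum_t p t * ln (ph (h t)).
  rewrite [RHS](partition_big h xpredT)//=; apply: eq_bigr => u _.
  by rewrite {1}phE mulr_suml; apply: eq_bigr => t /eqP ->.
rewrite lerN2 -subr_le0 -sumrB.
apply: (@le_trans _ _ (\sum_t (q t - p t))); last first.
  by rewrite sumrB p1 subr_le0.
(* Termwise, ln s <= s - 1 is applied to s = [q t / ph (h t)]; since [p t <= ph (h t)], the product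
   of [p t] and s is at most [q t]. *)
apply: ler_sum => t _; have [pt0|] := eqVneq (p t) 0.
  by rewrite pt0 !mul0r subrr subr0.
move=> ptN0; have pt : 0 < p t by rewrite lt_def ptN0 p0.
have qt := pq _ pt; have le_ph : p t <= ph (h t).
  by rewrite phE (bigD1 t)//= lerDl sumr_ge0.
have ph0 : 0 < ph (h t) by exact: lt_le_trans le_ph.
rewrite -mulrBr -ln_div ?posrE//.
have ratio0 : 0 < q t / ph (h t) by rewrite divr_gt0.
have : ln (q t / ph (h t)) <= q t / ph (h t) - 1.
  have /le_ln1Dx : -1 < q t / ph (h t) - 1 by lra.
  by rewrite addrC subrK.
move=> le1; apply: le_trans (ler_wpM2l (ltW pt) le1) _.
rewrite mulrBr mulr1 lerD2r mulrCA ler_piMr// ?q0// ler_pdivrMr// mul1r//.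
Qed.

Section finite_labels.
Context {R : realType} {d : nat} (mu : probability (borel_shift d) R).
Implicit Types (A B : set (borel_shift d)) (T U : finType).

Definition prob A : R := fine (mu A).

Lemma prob_fin A : measurable A -> (prob A)%:E = mu A.
Proof. by move=> mA; rewrite fineK// fin_num_measure. Qed.

Lemma prob_ge0 A : 0 <= prob A.
Proof. exact: fine_ge0. Qed.

Lemma probT : prob setT = 1.
Proof. by rewrite /prob probability_setT. Qed.

Lemma prob0 : prob set0 = 0.
Proof. by rewrite /prob measure0. Qed.

Lemma probU A B : measurable A -> measurable B -> A `&` B = set0 ->
  prob (A `|` B) = prob A + prob B.
Proof. by move=> mA mB AB; rewrite /prob measureU// fineD// fin_num_measure. Qed.

Lemma le_prob A B : measurable A -> measurable B -> A `<=` B -> prob A <= prob B.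
Proof.
by move=> mA mB AB; rewrite -lee_fin !prob_fin//; apply: le_measure; rewrite ?inE.
Qed.

Lemma probC A : measurable A -> prob (~` A) = 1 - prob A.
Proof.
move=> mA; apply/eqP; rewrite eq_sym subr_eq addrC -probU ?setICr//.
  by rewrite setUv probT.
exact: measurableC.
Qed.

Lemma le_probU A B : measurable A -> measurable B -> prob (A `|` B) <= prob A + prob B.
Proof.
move=> mA mB; rewrite -(setDUK (B := A `|` B) (A := A)); last by move=> ?; left.
rewrite probU//; first last.
- by rewrite setDIK.
- by apply: measurableD => //; exact: measurableU.
rewrite lerD2l le_prob//.
- by apply: measurableD => //; exact: measurableU.
- by move=> x [[]].
Qed.

(** For [T = 'I_k] this unfolds to [measurable_partition]; general finite types are needed for joint
    labels and blocks. *)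
Definition finite_label T (f : full_shift d -> T) :=
  forall t, measurable (f @^-1` [set t] : set (borel_shift d)).

Lemma finite_label_preimage T (f : full_shift d -> T) (P : set T) :
  finite_label f -> measurable (f @^-1` P : set (borel_shift d)).
Proof.
move=> mf; rewrite (_ : _ @^-1` _ = \bigcup_(t in P) (f @^-1` [set t])).
  by apply: fin_bigcup_measurable => // t _; exact: mf.
rewrite eqEsubset; split=> [x Px|x [t Pt /= ft]]; first by exists (f x).
by rewrite /preimage/= ft.
Qed.

Lemma finite_label_pair T U (f : full_shift d -> T) (g : full_shift d -> U) :
  finite_label f -> finite_label g -> finite_label (fun x => (f x, g x)).
Proof.
move=> mf mg [t u]; rewrite (_ : _ @^-1` _ = f @^-1` [set t] `&` g @^-1` [set u]).
  by apply: measurableI; [exact: mf|exact: mg].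
rewrite eqEsubset; split=> [x [e1 e2]|x [/= e1 e2]]; first by split.
by rewrite /preimage/= e1 e2.
Qed.

Lemma finite_label_iter T (f : full_shift d -> T) k :
  finite_label f -> finite_label (fun x => f (iter k (@shift d) x)).
Proof.
elim: k => [//|k IHk] mf t.
rewrite (_ : _ @^-1` _ = @shift d @^-1` ((fun x => f (iter k (@shift d) x)) @^-1` [set t])).
  by rewrite -[X in measurable X]setTI; apply: (@shift_measurable d) => //; exact: IHk.
by rewrite eqEsubset; split=> x; rewrite /preimage/= -iterSr.
Qed.

Lemma finite_label_ffun T n (f : 'I_n -> full_shift d -> T) :
  (forall i, finite_label (f i)) -> finite_label (fun x => [ffun i => f i x]).
Proof.
move=> mf t; rewrite (_ : _ @^-1` _ = \bigcap_(i in [set: 'I_n]) (f i @^-1` [set t i])).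
  by apply: fin_bigcap_measurable => // i _; exact: mf.
rewrite eqEsubset; split=> [x /= <- i _ /=|x xt]; first by rewrite ffunE.
by apply/ffunP => i; rewrite ffunE; exact: xt.
Qed.

Lemma finite_label_block m n : finite_label (fun x => block x m n).
Proof. by move=> w; apply: local_set_measurable; exact: local_set_block. Qed.

Lemma prob_preimage_seq T (f : full_shift d -> T) (s : seq T) : finite_label f -> uniq s ->
  prob (f @^-1` [set` s]) = \sum_(t <- s) prob (f @^-1` [set t]).
Proof.
move=> mf; elim: s => [_|t s IHs /= /andP[ts us]].
  by rewrite big_nil set_nil preimage_set0 prob0.
rewrite big_cons -IHs// -probU//.
- congr prob; rewrite eqEsubset; split=> x; rewrite /preimage/= in_cons.
    by move=> /predU1P.
  by move=> xs; apply/predU1P.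
- exact: finite_label_preimage.
- by rewrite -preimage_setI -subset0 => x [/= ->]; rewrite (negbTE ts).
Qed.

Lemma prob_preimage T (f : full_shift d -> T) (P : pred T) : finite_label f ->
  prob (f @^-1` [set t | P t]) = \sum_(t | P t) prob (f @^-1` [set t]).
Proof.
move=> mf; rewrite -big_enum -prob_preimage_seq ?enum_uniq//.
by congr (prob (_ @^-1` _)); rewrite eqEsubset; split=> t /=; rewrite mem_enum.
Qed.

Definition expect T (f : full_shift d -> T) (F : T -> R) : R :=
  \sum_t prob (f @^-1` [set t]) * F t.

Lemma expect_comp T U (f : full_shift d -> T) (h : T -> U) (F : U -> R) :
  finite_label f -> expect (h \o f) F = expect f (F \o h).
Proof.
move=> mf; rewrite /expect [RHS](partition_big h xpredT)//=; apply: eq_bigr => u _.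
rewrite (_ : (h \o f) @^-1` [set u] = f @^-1` [set t | h t == u]); last first.
  by rewrite eqEsubset; split=> x /= /eqP.
rewrite prob_preimage// mulr_suml; apply: eq_bigr => t /eqP <- //.
Qed.

Lemma sum_prob T (f : full_shift d -> T) : finite_label f ->
  \sum_t prob (f @^-1` [set t]) = 1.
Proof. by move=> mf; rewrite -(prob_preimage xpredT mf) -probT; congr prob; rewrite eqEsubset. Qed.

Section invariant.
Hypothesis mu_inv : forall A, measurable A -> mu (@shift d @^-1` A) = mu A.

Lemma prob_iter A k : measurable A -> prob (iter k (@shift d) @^-1` A) = prob A.
Proof.
move=> mA; elim: k => [//|k IHk].
rewrite (_ : _ @^-1` _ = @shift d @^-1` (iter k (@shift d) @^-1` A)); last first.
  by rewrite eqEsubset; split=> x; rewrite /preimage/= -iterSr.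
rewrite -IHk /prob mu_inv//; elim: k {IHk} => [//|k IHk].
rewrite (_ : _ @^-1` _ = @shift d @^-1` (iter k (@shift d) @^-1` A)).
  by rewrite -[X in measurable X]setTI; apply: (@shift_measurable d).
by rewrite eqEsubset; split=> x; rewrite /preimage/= -iterSr.
Qed.

Lemma expect_iter T (f : full_shift d -> T) F k : finite_label f ->
  expect (fun x => f (iter k (@shift d) x)) F = expect f F.
Proof. by move=> mf; apply: eq_bigr => t _; rewrite -[in RHS](prob_iter k). Qed.

End invariant.

Section potential_integral.
Variables (X : set (full_shift d)) (phi : full_shift d -> R).
Hypothesis hphi : continuous phi.
Hypothesis closedX : closed X.
Hypothesis muX : mu X = 1%E.

Let mX : measurable (X : set (borel_shift d)) := closed_measurable closedX.

Lemma potential_measurable : measurable_fun [set: borel_shift d] phi.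
Proof.
apply: (measurability _ (RGenOpens.measurableE R)).
move=> _ [_ [a [b ->]] <-]; rewrite setTI; apply: sub_sigma_algebra.
apply: open_comp => [x _|]; [exact: hphi|exact: interval_open].
Qed.

Lemma potential_integrable (A : set (borel_shift d)) : measurable A ->
  mu.-integrable A (EFin \o phi).
Proof.
move=> mA; have [B phiB] := potential_bounded hphi.
apply: measurable_bounded_integrable => //.
- by rewrite (le_lt_trans (probability_le1 _ mA))// ltry.
- exact: measurable_funS potential_measurable.
- exists B; split; first exact: num_real.
  by move=> M ltBM x _ /=; rewrite (le_trans (phiB x))// ltW.
Qed.

(** Bridge from the Lebesgue integral to finite expectations: the complement of [X] is null, and on
    each window cylinder the potential stays within [e] of its sample value. *)
Lemma potential_integral_approx N (e : R) :
  (forall x y, window N x = window N y -> `|phi x - phi y| <= e) ->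
  exists I, (\int[mu]_(x in X) (phi x)%:E = I%:E)%E /\
    `|I - expect (window N) (phi \o @word_point d N)| <= e.
Proof.
move=> phie; exists (Rintegral mu X phi); split.
  by rewrite fineK// integrable_fin_num// potential_integrable.
have mw : finite_label (window N) by exact: finite_label_block.
have -> : Rintegral mu X phi = Rintegral mu setT phi.
  rewrite /Rintegral (@negligible_integral _ _ _ mu setT (~` X)) ?setTD ?setCK//.
  - exact: measurableC.
  - exact: potential_integrable.
  - by rewrite -prob_fin ?probC ?/prob ?muX ?subrr//; exact: measurableC.
have -> : Rintegral mu setT phi = \sum_w Rintegral mu (window N @^-1` [set w]) phi.
  rewrite /Rintegral sum_fine; last first.
    by move=> w _; rewrite integrable_fin_num// ?potential_integrable//; exact: mw.
  rewrite -integral_bigsetU_EFin ?index_enum_uniq//.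
  - congr (fine (integral _ _ _)); rewrite -bigcup_seq eqEsubset; split=> // x _.
    by exists (window N x) => //=; rewrite mem_index_enum.
  - by apply/trivIsetP => v w _ _ /eqP vw; rewrite -subset0 => x [/= -> /vw].
  - by apply/measurable_EFinP; exact: measurable_funS potential_measurable.
rewrite /expect -sumrB (le_trans (ler_norm_sum _ _ _))//.
rewrite -[leRHS]mul1r -(sum_prob mw) mulr_suml ler_sum// => w _.
set F : set (borel_shift d) := window N @^-1` [set w]; have mF : measurable F := mw w.
have cstI (c : R) : mu.-integrable F (EFin \o cst c).
  exact: finite_measure_integrable_cst.
have near x : F x -> `|phi x - phi (word_point w)| <= e.
  by move=> Fx; apply: phie; rewrite window_word_point.
rewrite ler_norml; apply/andP; split.
  rewrite lerBrDl -mulrBr mulrC -Rintegral_cst//; apply: le_Rintegral => //.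
  - exact: cstI.
  - exact: potential_integrable.
  by move=> x /near /=; rewrite ler_norml; lra.
rewrite lerBlDl -mulrDr mulrC -Rintegral_cst//; apply: le_Rintegral => //.
- exact: potential_integrable.
- exact: cstI.
by move=> x /near /=; rewrite ler_norml; lra.
Qed.

End potential_integral.
End finite_labels.

(** * Approximation of Borel sets by local sets *)

Section approximation.
Context {R : realType} {d : nat} (mu : probability (borel_shift d) R).
Implicit Types A B C : set (borel_shift d).

Definition symdiff A B : set (borel_shift d) := (A `\` B) `|` (B `\` A).

Lemma symdiff_measurable A B : measurable A -> measurable B -> measurable (symdiff A B).
Proof. by move=> mA mB; apply: measurableU; exact: measurableD. Qed.

Lemma symdiffU A B C D :
  symdiff (A `|` B) (C `|` D) `<=` symdiff A C `|` symdiff B D.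
Proof.
move=> x [[[Ax|Bx] /not_orP[nC nD]]|[[Cx|Dx] /not_orP[nA nB]]].
- by left; left.
- by right; left.
- by left; right.
- by right; right.
Qed.

Definition approximable A := measurable A /\
  forall e : R, 0 < e -> exists2 C, local_set C & prob mu (symdiff A C) < e.

Lemma local_approximable A : local_set A -> approximable A.
Proof.
move=> lA; split; first exact: local_set_measurable.
by move=> e e0; exists A => //; rewrite /symdiff setDv setU0 prob0.
Qed.

Lemma approximableC A : approximable A -> approximable (~` A).
Proof.
move=> [mA aA]; split; first exact: measurableC.
move=> e /aA[C lC AC]; exists (~` C); first exact: local_setC.
by rewrite /symdiff !setDE !setCK setUC [_ `&` C]setIC [_ `&` A]setIC -!setDE.
Qed.

Lemma approximableU A B : approximable A -> approximable B -> approximable (A `|` B).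
Proof.
move=> [mA aA] [mB aB]; split; first exact: measurableU.
move=> e e0; have e20 : 0 < e / 2 by rewrite divr_gt0.
have [C lC AC] := aA _ e20; have [D lD BD] := aB _ e20.
have mC := local_set_measurable lC; have mD := local_set_measurable lD.
exists (C `|` D); first exact: local_setU.
apply: (@le_lt_trans _ _ (prob mu (symdiff A C) + prob mu (symdiff B D))); last by lra.
apply: le_trans (le_probU _ _ _) => //; try exact: symdiff_measurable.
apply: le_prob; last exact: symdiffU.
- by apply: symdiff_measurable; exact: measurableU.
- by apply: measurableU; exact: symdiff_measurable.
Qed.

(** Half of the error truncates the union to a finite one, by continuity from below; the other half
    approximates that finite union. *)
Lemma approximable_bigcup (F : nat -> set (borel_shift d)) :
  (forall n, approximable (F n)) -> approximable (\bigcup_n F n).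
Proof.
move=> aF; have mF n : measurable (F n) := (aF n).1.
have mUF : measurable (\bigcup_n F n) by exact: bigcupT_measurable.
split=> // e e0; have e20 : 0 < e / 2 by rewrite divr_gt0.
pose G n := \bigcup_(i in [set k | (k <= n)%N]) F i.
have GS n : G n.+1 = G n `|` F n.+1.
  rewrite eqEsubset; split=> [x [i /= lein Fix]|x [[i /= lein Fix]|Fx]].
  - move: lein; rewrite leq_eqVlt => /predU1P[<-|lein]; first by right.
    by left; exists i.
  - by exists i => //=; exact: leqW.
  - by exists n.+1 => /=.
have aG n : approximable (G n).
  elim: n => [|n IHn]; last by rewrite GS; exact: approximableU.
  rewrite (_ : G 0%N = F 0%N)// eqEsubset; split=> [x [[|//] _ Fx]//|x Fx].
  by exists 0%N.
have mG n := (aG n).1.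
have UG : \bigcup_n G n = \bigcup_n F n.
  rewrite eqEsubset; split=> [x [n _ [i _ Fix]]|x [i _ Fix]]; first by exists i.
  by exists i => //; exists i => /=.
have homoG : {homo G : n m / (n <= m)%N >-> (n <= m)%O}.
  move=> n m lenm; apply/subsetPset => x [i /= lein Fix].
  by exists i => //=; exact: leq_trans lenm.
have := @nondecreasing_cvg_mu _ _ _ mu G mG _ homoG; rewrite UG => /(_ mUF).
rewrite -(prob_fin mu mUF) => /fine_cvgP[_ /cvgrPdist_lt/(_ _ e20)[n _ /(_ n (leqnn n))]].
rewrite /= -/(prob mu (G n)) => /(le_lt_trans (ler_norm _)) ltn.
have [C lC GC] := (aG n).2 _ e20; exists C => //.
have mC := local_set_measurable lC.
have Gsub : G n `<=` \bigcup_n F n by move=> x [i _ Fix]; exists i.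
have mDG : measurable (\bigcup_n F n `\` G n) by exact: measurableD.
have probD : prob mu (\bigcup_n F n) = prob mu (G n) + prob mu (\bigcup_n F n `\` G n).
  by rewrite -probU// ?setDUK// setDIK.
apply: (@le_lt_trans _ _ (prob mu (\bigcup_n F n `\` G n) + prob mu (symdiff (G n) C))); last first.
  by rewrite probD in ltn; lra.
apply: le_trans (le_probU _ _ _) => //; last exact: symdiff_measurable.
apply: le_prob => //; first exact: symdiff_measurable.
  by apply: measurableU => //; exact: symdiff_measurable.
move=> x [[Fx nCx]|[Cx nFx]]; last by right; right; split=> // /Gsub.
by have [Gx|nGx] := pselect (G n x); [right; left|left].
Qed.

Lemma measurable_approximable A : measurable A -> approximable A.
Proof.
suff sub : <<s (@local_set d) >> `<=` approximable.
  by rewrite borel_shift_measurableE; exact: sub.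
apply: smallest_sub; last exact: local_approximable.
split.
- exact/local_approximable/local_set0.
- by move=> B aB; rewrite setTD; exact: approximableC.
- exact: approximable_bigcup.
Qed.

(** Each of the [k] atoms is within [e / k] of a local set, and a large window decides membership in
    all these local sets. Picking a label whose local set contains the window fails only on the
    union of the symmetric differences. *)
Lemma decoder_exists k (xi : full_shift d -> 'I_k) (e : R) :
  finite_label xi -> 0 < e -> exists N0, forall N, (N0 <= N)%N ->
  exists g : (N.*2.+1).-tuple 'I_d.+1 -> 'I_k,
    prob mu [set x | g (window N x) != xi x] <= e.
Proof.
move=> mxi e0; have k0 : (0 < k)%N by exact: leq_ltn_trans (ltn_ord (xi point)).
have ek0 : 0 < e / k%:R by rewrite divr_gt0// ltr0n.
have /choice[C CP] : forall a : 'I_k, exists C : set (full_shift d), local_set C /\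
    prob mu (symdiff (xi @^-1` [set a]) C) < e / k%:R.
  by move=> a; have [_ /(_ _ ek0)[C lC ?]] := measurable_approximable (mxi a); exists C.
have /choice[M MP] : forall a, exists N, forall x y, window N x = window N y -> C a x -> C a y.
  by move=> a; have [] := CP a.
pose D a := symdiff (xi @^-1` [set a]) (C a).
have mD a : measurable (D a).
  by apply: symdiff_measurable; [exact: mxi|apply: local_set_measurable; exact: (CP a).1].
exists (\max_a M a) => N leN.
pose g (w : (N.*2.+1).-tuple 'I_d.+1) : 'I_k :=
  odflt (xi point) [pick a | `[< C a (word_point w) >]].
exists g.
have leD (s : seq 'I_k) : prob mu (\bigcup_(a in [set` s]) D a) <= (size s)%:R * (e / k%:R).
  elim: s => [|a s IHs]; first by rewrite set_nil bigcup_set0 prob0 mul0r.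
  rewrite /= mulrS mulrDl mul1r.
  apply: (@le_trans _ _ (prob mu (D a `|` \bigcup_(b in [set` s]) D b))).
    apply: le_prob; first exact: fin_bigcup_measurable.
      by apply: measurableU => //; exact: fin_bigcup_measurable.
    move=> x [b /=]; rewrite in_cons => /predU1P[->|bs] Dbx; first by left.
    by right; exists b.
  apply: le_trans (le_probU _ _ _) _ => //.
    by apply: fin_bigcup_measurable => //.
  by rewrite lerD// ltW//; exact: (CP a).2.
have := leD (enum 'I_k); rewrite size_enum_ord.
rewrite mulrCA divff ?mulr1 ?pnatr_eq0 -?lt0n//; apply: le_trans.
have mE : measurable ([set x | g (window N x) != xi x] : set (borel_shift d)).
  have mw : finite_label (fun x => (window N x, xi x)).
    by apply: finite_label_pair => //; exact: finite_label_block.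
  exact: (finite_label_preimage [set t | g t.1 != t.2] mw).
apply: le_prob => //; first exact: fin_bigcup_measurable.
move=> x /= gx; apply: contrapT => nD; move/eqP: gx; apply.
have xD a : ~ D a x.
  by move=> Dax; apply: nD; exists a => //=; rewrite mem_enum.
have Cx a : C a x <-> xi x = a.
  split=> [Cax|xa]; apply: contrapT => h; apply: (xD a); [by right; split|by left; split].
have Cw a : C a (word_point (window N x)) <-> xi x = a.
  rewrite -Cx; have leMN : (M a <= N)%N by apply: leq_trans leN; exact: leq_bigmax.
  have e1 := window_mono leMN (window_word_point (window N x)).
  by split; apply: MP; rewrite e1.
rewrite /g; case: pickP => [a /asboolP/Cw //|] /(_ (xi x)) /asboolP; case; exact/Cw.
Qed.

End approximation.

(** * The variational principle *)

Section variational_principle.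
Context {R : realType} {d : nat} (mu : probability (borel_shift d) R).
Variables (X : set (full_shift d)) (phi : full_shift d -> R) (B : R).
Hypothesis sX : shift_space X.
Hypothesis hphi : continuous phi.
Hypothesis phiB : forall x, `|phi x| <= B.
Hypothesis inv : invariant_measure X mu.

Let closedX : closed X. Proof. by case: sX. Qed.
Let muX : mu X = 1%E. Proof. exact: inv.1. Qed.

(** Used to realise every joint value of positive probability by a point of [X], so that its word is
    in the language. *)
Lemma prob_gt0_meets (A : set (borel_shift d)) :
  measurable A -> 0 < prob mu A -> exists2 x, X x & A x.
Proof.
move=> mA pA; apply: contrapT => nX; move: pA; apply/negP; rewrite -leNgt.
have mX := closed_measurable closedX.
apply: (@le_trans _ _ (prob mu (~` X))).
  apply: le_prob => //; first exact: measurableC.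
  by move=> x Ax Xx; apply: nX; exists x.
by rewrite probC// /prob muX subrr.
Qed.

Section partition.
Variables (k : nat) (xi : full_shift d -> 'I_k).
Hypothesis mxi : finite_label xi.
Variables (N : nat) (e eta : R) (g : (N.*2.+1).-tuple 'I_d.+1 -> 'I_k).
Hypothesis phie : forall x y, window N x = window N y -> `|phi x - phi y| <= e.
Hypothesis eta01 : 0 < eta < 1.

Let window_word := (N.*2.+1).-tuple 'I_d.+1.

Let k_gt0 : (0 < k)%N. Proof. exact: leq_ltn_trans (ltn_ord (xi point)). Qed.

(* A guess for the conditional law of [xi] given a window, concentrated on the
   value predicted by the decoder [g]. *)
Definition guess (a : 'I_k) (v : window_word) : R :=
  if a == g v then 1 - eta else eta / k%:R.

Lemma guess_gt0 a v : 0 < guess a v.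
Proof.
have /andP[e0 e1] := eta01.
by rewrite /guess; case: ifP => _; [rewrite subr_gt0|rewrite divr_gt0// ltr0n].
Qed.

Lemma sum_guess v : \sum_a guess a v <= 1.
Proof.
have /andP[e0 e1] := eta01.
rewrite (bigD1 (g v))//= {1}/guess eqxx.
apply: (@le_trans _ _ (1 - eta + \sum_(a < k) eta / k%:R)).
  rewrite lerD2l [leRHS](bigID (fun a => a != g v))/= ler_wpDr//.
    by apply: sumr_ge0 => a _; rewrite divr_ge0// ltW.
  by apply: ler_sum => a /negbTE nav; rewrite /guess nav.
rewrite sumr_const card_ord -[_ *+ k]mulr_natr divfK ?pnatr_eq0 -?lt0n//.
by rewrite subrK.
Qed.

(** Contribution of one coordinate to the logarithm of the comparison law in Gibbs' inequality. *)
Definition payoff (av : 'I_k * window_word) : R :=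
  phi (word_point av.2) + ln (guess av.1 av.2).

Definition mean_payoff : R := expect mu (fun x => (xi x, window N x)) payoff.

Let mxiw : finite_label (fun x => (xi x, window N x)).
Proof. by apply: finite_label_pair => //; exact: finite_label_block. Qed.

Section fixed_length.
Variable n : nat.
(** The windows around the coordinates 0, ..., n-1 cover the positions from -N to n+N-1. The sum is
    bracketed as the Birkhoff sum will be cut. *)
Let L := (N + (n + N))%N.
Let word := L.-tuple 'I_d.+1.

Let joint_label (x : full_shift d) : {ffun 'I_n -> 'I_k} * word :=
  ([ffun i : 'I_n => xi (iter i (@shift d) x)], block x (- N%:Z) L).

Let mjoint : finite_label joint_label.
Proof.
apply: finite_label_pair; last exact: finite_label_block.
by apply: finite_label_ffun => i; exact: finite_label_iter.
Qed.

Let subword (w : word) (i : 'I_n) : window_word :=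
  [tuple nth ord0 w (i + j) | j < N.*2.+1].

Let subword_block x i :
  subword (block x (- N%:Z) L) i = window N (iter i (@shift d) x).
Proof.
apply: eq_from_tnth => j; rewrite !tnth_mktuple nth_block.
  by rewrite iter_shift; congr (x _); lia.
by rewrite /L; have := ltn_ord i; have := ltn_ord j; lia.
Qed.

Let word_law (w : word) : R :=
  if w \in language X L then
    expR (cylinder_sup phi X w) / partition_sum phi X L else 0.

Let Z_gt0 : 0 < partition_sum phi X L. Proof. exact: partition_sum_gt0 phiB _ sX L. Qed.

Let joint_law (t : {ffun 'I_n -> 'I_k} * word) : R :=
  word_law t.2 * \prod_(i < n) guess (t.1 i) (subword t.2 i).

Let joint_law_ge0 t : 0 <= joint_law t.
Proof.
rewrite mulr_ge0//; last by apply: prodr_ge0 => i _; exact/ltW/guess_gt0.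
by rewrite /word_law; case: ifP => // _; rewrite divr_ge0 ?expR_ge0// ltW.
Qed.

Let sum_joint_law : \sum_t joint_law t <= 1.
Proof.
rewrite -(pair_bigA _ (fun f w => joint_law (f, w)))/= exchange_big/=.
have word_law_ge0 w : 0 <= word_law w.
  by rewrite /word_law; case: ifP => // _; rewrite divr_ge0 ?expR_ge0// ltW.
apply: (@le_trans _ _ (\sum_w word_law w)).
  apply: ler_sum => w _; rewrite /joint_law/= -mulr_sumr ler_piMr//.
  (* For a fixed word, the sum over all labellings factors into one sum of guesses per
     coordinate. *)
  rewrite -(bigA_distr_bigA (fun i a => guess a (subword w i))).
  apply: prodr_ile1 => i _; rewrite sum_guess andbT.
  by apply: sumr_ge0 => a _; exact/ltW/guess_gt0.
rewrite /word_law -big_mkcond/= -mulr_suml divff// gt_eqF//.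
Qed.

(** A point of [X] realising [t] bounds the cylinder supremum from below. Sampling the potential on
    windows loses at most [e] at each of [n] coordinates, and the [N] coordinates at either end lose
    at most [B] each. *)
Let joint_law_bound t : 0 < prob mu (joint_label @^-1` [set t]) ->
  0 < joint_law t /\
  \sum_(i < n) payoff (t.1 i, subword t.2 i) - n%:R * e - N.*2%:R * B
    - ln (partition_sum phi X L) <= ln (joint_law t).
Proof.
move=> /(prob_gt0_meets (mjoint t))[x Xx /= xt].
have tw : block x (- N%:Z) L = t.2 by rewrite -xt.
have Lw : t.2 \in language X L.
  by apply/mem_set; rewrite -tw; exists x => //; exists (- N%:Z).
have word_lawE : word_law t.2 = expR (cylinder_sup phi X t.2) / partition_sum phi X L.
  by rewrite /word_law Lw.
have word_law_gt0 : 0 < word_law t.2 by rewrite word_lawE divr_gt0 ?expR_gt0.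
have prod_gt0 : 0 < \prod_(i < n) guess (t.1 i) (subword t.2 i).
  by apply: prodr_gt0 => i _; exact: guess_gt0.
split; first by rewrite mulr_gt0.
rewrite lnM ?posrE// word_lawE ln_div ?posrE ?expR_gt0// expRK.
have -> : ln (\prod_(i < n) guess (t.1 i) (subword t.2 i)) =
    \sum_(i < n) ln (guess (t.1 i) (subword t.2 i)).
  elim: (index_enum _) => [|i s IHs]; first by rewrite !big_nil ln1.
  rewrite !big_cons lnM ?posrE ?guess_gt0 ?IHs//.
  by apply: prodr_gt0 => j _; exact: guess_gt0.
have -> : \sum_(i < n) payoff (t.1 i, subword t.2 i) =
    \sum_(i < n) phi (word_point (subword t.2 i)) +
    \sum_(i < n) ln (guess (t.1 i) (subword t.2 i)) by rewrite -big_split.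
suff : \sum_(i < n) phi (word_point (subword t.2 i)) - n%:R * e - N.*2%:R * B
    <= cylinder_sup phi X t.2 by lra.
(* Cylinders are anchored at 0, whereas the block of [x] starts at -N. *)
pose y := translate (- N%:Z) x.
have Xy : X y by exact: shift_space_translate.
have yN : iter N (@shift d) y = x.
  by apply/funext => i; rewrite iter_shift /y /translate; congr (x _); lia.
have yw : block y 0 L = t.2 by rewrite block_translate add0r.
rewrite -yw; apply: le_trans (birkhoff_le_cylinder_sup phiB L Xy).
rewrite /L birkhoff_sumD birkhoff_sumD yN.
have := birkhoff_sum_bound phiB N y.
have := birkhoff_sum_bound phiB N (iter n (@shift d) x).
have : \sum_(i < n) phi (word_point (subword (block y 0 L) i)) - n%:R * e <=
    birkhoff_sum phi n x.
  have -> : n%:R * e = \sum_(i < n) e by rewrite sumr_const card_ord mulr_natl.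
  rewrite yw -tw lerBlDr -big_split/=.
  apply: ler_sum => i _; rewrite subword_block.
  have := phie (window_word_point (window N (iter i (@shift d) x))).
  by rewrite ler_norml; lra.
rewrite !ler_norml -addnn natrD -/L; lra.
Qed.

Lemma join_entropy_bound : join_entropy mu xi n <=
  ln (partition_sum phi X L) + N.*2%:R * B + n%:R * (e - mean_payoff).
Proof.
pose h (t : {ffun 'I_n -> 'I_k} * word) := [tuple t.1 i | i < n].
pose p t := prob mu (joint_label @^-1` [set t]).
have itinE : itinerary xi n = h \o joint_label.
  by apply/funext => x; apply: eq_from_tnth => i; rewrite !tnth_mktuple ffunE.
have := @gibbs_inequality R _ _ h p joint_law
  (fun u => prob mu (itinerary xi n @^-1` [set u])).
move=> /(_ _ _ joint_law_ge0 sum_joint_law _ _) gibbs.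
apply: le_trans (gibbs _ _ _ _) _.
- by move=> t; exact: prob_ge0.
- exact: sum_prob.
- by move=> t /joint_law_bound[].
- move=> u; rewrite itinE -(prob_preimage mu (fun t => h t == u) mjoint).
  by congr prob; rewrite eqEsubset; split=> x /= /eqP.
rewrite lerNl.
(* By invariance of [mu], all coordinates have the same mean payoff. *)
have avg : \sum_t p t * \sum_(i < n) payoff (t.1 i, subword t.2 i) = n%:R * mean_payoff.
  under eq_bigr do rewrite mulr_sumr.
  rewrite exchange_big/= -[n in RHS]card_ord mulr_natl -sumr_const.
  apply: eq_bigr => i _.
  rewrite -[LHS]/(expect mu joint_label (payoff \o
    (fun t : {ffun 'I_n -> 'I_k} * word => (t.1 i, subword t.2 i)))).
  rewrite -expect_comp// /mean_payoff -(expect_iter inv.2 payoff i mxiw).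
  congr (expect mu _ payoff).
  by apply/funext => x /=; rewrite ffunE subword_block.
apply: (@le_trans _ _ (\sum_t p t * (\sum_(i < n) payoff (t.1 i, subword t.2 i) -
    (n%:R * e + N.*2%:R * B + ln (partition_sum phi X L))))).
  under eq_bigr do rewrite mulrBr.
  by rewrite sumrB avg -mulr_suml sum_prob//; lra.
apply: ler_sum => t _; have [->|pt0] := eqVneq (p t) 0; first by rewrite !mul0r.
have pt : 0 < p t by rewrite lt_def pt0 prob_ge0.
by rewrite ler_pM2l//; have [_] := joint_law_bound pt; lra.
Qed.

End fixed_length.

Lemma mean_payoff_ge (delta I : R) :
  prob mu [set x | g (window N x) != xi x] <= delta ->
  `|I - expect mu (window N) (phi \o @word_point d N)| <= e ->
  I - e + ln (1 - eta) + delta * ln (eta / k%:R) <= mean_payoff.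
Proof.
move=> gxi Ie; have /andP[eta0 eta1] := eta01.
have ln_eta : ln (eta / k%:R) <= 0.
  rewrite ln_le0// ler_pdivrMr ?ltr0n// mul1r (le_trans (ltW eta1))//.
  by rewrite ler1n.
have ln_1eta : ln (1 - eta) <= 0 by rewrite ln_le0//; lra.
have -> : mean_payoff = expect mu (window N) (phi \o @word_point d N) +
    expect mu (fun x => (xi x, window N x)) (fun av => ln (guess av.1 av.2)).
  rewrite -[window N in RHS]/(snd \o (fun x => (xi x, window N x))) expect_comp//.
  by rewrite /expect -big_split/=; apply: eq_bigr => av _; rewrite -mulrDr.
suff : ln (1 - eta) + delta * ln (eta / k%:R) <=
    expect mu (fun x => (xi x, window N x)) (fun av => ln (guess av.1 av.2)).
  by move: Ie; rewrite ler_norml; lra.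
(* Both logarithms are nonpositive, so [ln (1 - eta)] may be charged everywhere and [ln (eta / k)]
   on top of it where the decoder errs. *)
apply: (@le_trans _ _ (expect mu (fun x => (xi x, window N x))
    (fun av => ln (1 - eta) + (g av.2 != av.1)%:R * ln (eta / k%:R)))); last first.
  apply: ler_sum => -[a v] _; rewrite ler_wpM2l ?prob_ge0//= /guess eq_sym.
  by case: ifP => _ /=; rewrite ?mul0r ?mul1r; lra.
rewrite /expect; under eq_bigr do rewrite mulrDr mulrA.
rewrite big_split/= -!mulr_suml sum_prob// mul1r lerD2l.
rewrite (_ : \sum_i _ = prob mu [set x | g (window N x) != xi x]).
  exact: ler_wnM2r.
rewrite (_ : [set x | _] = (fun x => (xi x, window N x)) @^-1` [set t | g t.2 != t.1])//.
rewrite (prob_preimage mu (fun t => g t.2 != t.1) mxiw) [RHS]big_mkcond.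
by apply: eq_bigr => t _; case: ifP => _; rewrite ?mulr1 ?mulr0.
Qed.

End partition.

Lemma partition_entropy_le k (xi : full_shift d -> 'I_k) (I : R) :
  finite_label xi -> (\int[mu]_(x in X) (phi x)%:E = I%:E)%E ->
  cvgn (fun n : nat => n%:R^-1 * join_entropy mu xi n : R) ->
  partition_entropy mu xi + I <= pressure X phi.
Proof.
move=> mxi intI cvh; rewrite leNgt; apply/negP => ltP.
(* Seven errors of at most [tau] arise: two from the limits defining entropy and pressure, one from
   the boundary term [K], one from oscillation in [bound], three from [payoff_ge]. The assumed gap
   is [8 * tau]. *)
pose tau := (partition_entropy mu xi + I - pressure X phi) / 8.
have tau0 : 0 < tau by rewrite divr_gt0// subr_gt0.
have k_gt0 : (0 < k)%N by exact: leq_ltn_trans (ltn_ord (xi point)).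
pose eta := 1 - expR (- tau).
have eta01 : 0 < eta < 1.
  by rewrite subr_gt0 expR_lt1 oppr_lt0 tau0/= gtrBl expR_gt0.
have ln_eta : ln (1 - eta) = - tau by rewrite /eta subKr expRK.
(* The decoder's total penalty stays below [tau]; the summand 1 keeps the denominator positive. *)
pose delta := tau / (1 + `|ln (eta / k%:R)|).
have den0 : 0 < 1 + `|ln (eta / k%:R)| by rewrite ltr_pwDl.
have delta0 : 0 < delta by rewrite divr_gt0.
have delta_ln : - tau <= delta * ln (eta / k%:R).
  have : delta * `|ln (eta / k%:R)| <= tau.
    by rewrite /delta mulrAC ler_pdivrMr// ler_pM2l// lerDr.
  have : - (delta * `|ln (eta / k%:R)|) <= delta * ln (eta / k%:R).
    by rewrite -mulrN ler_pM2l// lerNl -normrN ler_norm.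
  lra.
have [N1 N1P] := uniform_window hphi tau0.
have [N2 N2P] := decoder_exists mu mxi delta0.
pose N := maxn N1 N2; have [g gxi] := N2P N (leq_maxr _ _).
have phie x y : window N x = window N y -> `|phi x - phi y| <= tau.
  by move=> xy; apply/ltW/(N1P N) => //; exact: leq_maxl.
have [I' []] := potential_integral_approx hphi closedX muX phie.
rewrite intI => -[<-] IE.
have := mean_payoff_ge mxi eta01 gxi IE; rewrite ln_eta => payoff_ge.
have bound n : join_entropy mu xi n <= ln (partition_sum phi X (N + (n + N))) +
    N.*2%:R * B + n%:R * (tau - mean_payoff xi eta g) by exact: join_entropy_bound.
have [cvP _] := pressure_cvg phiB sX.
have /cvgrPdist_le/(_ _ tau0)[n1 _ n1P] := cvP.
have /cvgrPdist_le/(_ _ tau0)[n2 _ n2P] := cvh.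
(* Cost of the 2N extra letters, in the length of the partition sum and in the Birkhoff sum. *)
pose K := N.*2%:R * (pressure X phi + tau + B).
pose n := maxn (maxn n1 n2) (Num.truncn (`|K| / tau)).+1.
have nR0 : 0 < n%:R :> R by rewrite ltr0n leq_max orbT.
have nK : K <= n%:R * tau.
  rewrite (le_trans (ler_norm _))// -ler_pdivrMr// (le_trans (ltW (truncnS_gt _)))//.
  by rewrite ler_nat leq_maxr.
have n1n : (n1 <= n)%N by rewrite !leq_max leqnn.
have n2n : (n2 <= n)%N by rewrite !leq_max leqnn orbT.
have n1L : (n1 <= N + (n + N))%N by rewrite (leq_trans n1n)// addnCA leq_addr.
clearbody n; have /ler_normlP[_ hn] := n2P _ n2n.
have /ler_normlP[Zn _] := n1P _ n1L.
have LE : (N + (n + N))%:R = n%:R + N.*2%:R :> R by rewrite -natrD addnCA addnn.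
have LR0 : 0 < (N + (n + N))%:R :> R by rewrite LE ltr_wpDr.
have := bound n; move: Zn hn; rewrite -/(partition_entropy mu xi).
move: (join_entropy _ _ _) (ln _) => H Z Zn hn.
have {}Zn : Z <= (n%:R + N.*2%:R) * (pressure X phi + tau).
  by rewrite -LE -ler_pdivrMl//; lra.
have {}hn : n%:R * (partition_entropy mu xi - tau) <= H.
  by rewrite -ler_pdivlMl//; lra.
move=> HZ.
have : n%:R * (partition_entropy mu xi - tau) <= n%:R * (pressure X phi + tau) + K
    + n%:R * (tau - mean_payoff xi eta g).
  by rewrite /K; lra.
have -> : partition_entropy mu xi = 8 * tau - I + pressure X phi by rewrite /tau; field.
have : n%:R * (I - tau - tau - tau) <= n%:R * mean_payoff xi eta g.
  by rewrite ler_pM2l//; lra.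
have : 0 < n%:R * tau by rewrite mulr_gt0.
lra.
Qed.

(** The one-atom partition witnesses that entropy is nonnegative, and later stands in for divergent
    entropy sequences. *)
Lemma finite_label_trivial : @finite_label d 'I_1 (fun=> ord0).
Proof.
move=> a; rewrite (_ : _ @^-1` _ = setT)//.
by rewrite eqEsubset; split=> // x _; rewrite /preimage/= (ord1 a).
Qed.

Lemma join_entropy_trivial n : join_entropy mu (fun=> ord0 : 'I_1) n = 0.
Proof.
rewrite /join_entropy big1 ?oppr0// => w _.
rewrite (_ : itinerary _ n @^-1` _ = setT).
  by rewrite probability_setT/= ln1 mulr0.
rewrite eqEsubset; split=> // x _; apply: eq_from_tnth => i.
by rewrite !ord1.
Qed.

Lemma partition_entropy_trivial : partition_entropy mu (fun=> ord0 : 'I_1) = 0.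
Proof.
rewrite /partition_entropy; apply/cvg_lim => //.
rewrite (_ : (fun n => _) = cst 0); first exact: cvg_cst.
by apply/funext => n; rewrite join_entropy_trivial mulr0.
Qed.

Lemma entropy_ge0 : (0 <= entropy mu)%E.
Proof.
apply: ereal_sup_ubound; exists 1%N, (fun=> ord0 : 'I_1); split.
  exact: finite_label_trivial.
by rewrite partition_entropy_trivial.
Qed.

Lemma potential_integral_fin : exists I : R, (\int[mu]_(x in X) (phi x)%:E = I%:E)%E.
Proof.
have [N NP] := uniform_window hphi ltr01.
have [|I [? _]] := @potential_integral_approx _ _ mu _ _ hphi closedX muX N 1.
  by move=> x y xy; apply/ltW/(NP N).
by exists I.
Qed.

Lemma free_energy_le : (free_energy X phi mu <= (pressure X phi)%:E)%E.
Proof.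
have [I intI] := potential_integral_fin.
rewrite /free_energy intI -leeBrDr//.
apply: ge_ereal_sup => _ [k [xi [mxi ->]]]; rewrite -EFinB lee_fin lerBrDr.
have [cvh|dvh] := pselect (cvgn (fun n : nat => n%:R^-1 * join_entropy mu xi n : R)).
  exact: partition_entropy_le.
(* A divergent sequence has the junk limit 0, the entropy of the trivial partition. *)
have -> : partition_entropy mu xi = 0 by exact: dvgP.
rewrite -[X in X + _]partition_entropy_trivial.
apply: partition_entropy_le => //; first exact: finite_label_trivial.
rewrite (_ : (fun n => _) = cst 0); first exact: is_cvg_cst.
by apply/funext => n; rewrite join_entropy_trivial mulr0.
Qed.

End variational_principle.

(** * Non-computability of the pressure *)

Section limit_along_orbits.
Context {R : realType} {d : nat}.
Variables (x : nat -> full_shift d) (L : nat -> nat).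
Variables (U : set_system nat) (mu : probability (borel_shift d) R).
Hypothesis UU : UltraFilter U.
Hypothesis ooU : \oo `<=` U.
Hypothesis mu_lim : forall A, local_set A ->
  @visit_frequency R d x L A @ U --> fine (mu A).

(** A function of a window is a finite linear combination of indicators of local sets, so
    convergence of the visit frequencies suffices. *)
Lemma orbit_average_window N (F : (N.*2.+1).-tuple 'I_d.+1 -> R) :
  orbit_average x L (F \o window N) @ U --> expect mu (window N) F.
Proof.
have PU : ProperFilter U := @ultra_proper _ _ UU.
rewrite (_ : orbit_average _ _ _ =
    (fun n => \sum_w visit_frequency x L (window N @^-1` [set w]) n * F w)).
  rewrite /expect; elim: (index_enum _) => [|w s IHs].
    by rewrite big_nil; under eq_fun do rewrite big_nil; exact: cvg_cst.
  rewrite big_cons; under eq_fun do rewrite big_cons.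
  apply: cvgD => //; apply: cvgM; last exact: cvg_cst.
  by apply: mu_lim; exact: local_set_window.
apply/funext => n; under eq_bigr do rewrite -mulrA mulr_suml.
rewrite -mulr_sumr exchange_big/=; congr (_ * _); apply: eq_bigr => k _.
set y := iter _ _ _; rewrite (bigD1 (window N y))//= mem_set// mul1r big1 ?addr0//.
by move=> w /eqP wy; rewrite memNset ?mul0r// => /= yw; apply: wy.
Qed.

Variable X : set (full_shift d).
Hypothesis sX : shift_space X.
Hypothesis xX : forall n k, language X _ (window n (iter k (@shift d) (x n))).

Lemma language_window M N (y : full_shift d) : (M <= N)%N ->
  language X _ (window N y) -> language X _ (window M y).
Proof.
move=> leMN /(languageP _ (- N%:Z) sX)[z Xz zy]; exists z => //; exists (- M%:Z).
exact: window_mono leMN zy.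
Qed.

(** A window of radius [N] outside the language is never visited once [n >= N], so its cylinder is
    null. As [X] is closed, countably many such local sets cover its complement. *)
Lemma limit_measure_support : mu X = 1%E.
Proof.
have PU : ProperFilter U := @ultra_proper _ _ UU.
have [_ cX _] := sX.
have mX := closed_measurable cX.
pose A N : set (full_shift d) := window N @^-1` (~` language X N.*2.+1).
have A0 N : mu (A N) = 0%E.
  have lA : local_set (A N) by exact: local_set_window.
  rewrite -(prob_fin mu (local_set_measurable lA)); congr _%:E.
  rewrite /prob -(cvg_lim _ (mu_lim lA))//; apply/cvg_lim => //.
  apply: cvg_near_cst; apply: ooU; exists N => // n /= leNn.
  rewrite /visit_frequency /orbit_average big1 ?mulr0// => k _.
  by rewrite memNset// => /=; apply; exact: language_window (xX n k).
have nX : mu (~` X) = 0%E.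
  apply: measure_negligible; first exact: measurableC.
  apply: (@negligibleS _ _ _ mu (\bigcup_N A N)); last first.
    apply: negligible_bigcup => N; exists (A N); split=> //; last exact: A0.
    by apply: local_set_measurable; exact: local_set_window.
  move=> y nXy; have /nbhs_windowP[N NX] : nbhs y (~` X).
    by apply: open_nbhs_nbhs; split=> //; exact: closed_openC.
  exists N => // /(languageP _ (- N%:Z) sX)[z Xz /NX]; exact.
by rewrite -(prob_fin mu mX) -[X]setCK probC ?/prob ?nX/= ?subr0//; exact: measurableC.
Qed.

End limit_along_orbits.

(* The machine cannot tell [X0] from its zero-entropy approximants, whose pressure
   is nearly attained on an orbit segment. *)
Lemma computable_orbit_segments (R : realType) (d : nat) (X0 : set (full_shift d))
    (phi0 : full_shift d -> R) (n : nat) :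
  shift_space X0 -> continuous phi0 -> computable_at (@pressure R d) X0 phi0 ->
  exists (x : full_shift d) L, [/\ (n < L)%N,
    forall k, language X0 _ (window n (iter k (@shift d) x)) &
    pressure X0 phi0 - 3 * 2 ^- n <= L%:R^-1 * birkhoff_sum phi0 L x].
Proof.
move=> sX0 hphi0 [M MP]; have [Ophi OphiP] := potential_oracle_exists hphi0.
have [q [qs [_ q0 qX]]] := MP _ _ (conj (shift_oracle_ofP X0) OphiP) n.
(* The queried precisions make the approximant indistinguishable from [X0]; [n] makes its windows of
   radius [n] words of [X0]. *)
pose l := maxn n (\max_(m <- qs) m).
have [Y [sY YX [C YC]]] := approximant_exists l sX0.
(* Agreement is equality of lists, not of the sets listed, so the lists of [X0] are returned
   themselves. *)
pose OY k := if (k <= l)%N then shift_oracle_of X0 k else shift_oracle_of Y k.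
have OYP : shift_oracle Y OY.
  move=> k; rewrite /OY; case: leqP => lekl; last exact: shift_oracle_ofP.
  by rewrite YX; [exact: shift_oracle_ofP|rewrite ltnS leq_double].
have {}qX : `|ratr q - pressure Y phi0| < 2 ^- n.
  apply: qX => //; exists OY, Ophi; split; first by split.
  move=> m k mqs lekm; rewrite /OY ifT// (leq_trans lekm)//.
  by rewrite leq_max (leq_bigmax_seq (F := id))// orbT.
have [B phiB] := potential_bounded hphi0.
have e0 : 0 < 2 ^- n :> R by rewrite invr_gt0 exprn_gt0.
have [L [x [ltnL Yx xP]]] := good_orbit_segment phiB sY n YC e0.
exists x, L; split=> //.
  move=> k; rewrite -YX; last by rewrite ltnS leq_double leq_maxl.
  exists (iter k (@shift d) x); first exact: shift_space_iter.
  by exists (- n%:Z).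
(* Two of the three errors [2 ^- n] come from the machine's output [q], the third from the orbit
   segment. *)
move: q0 qX xP; move: (pressure X0 phi0) (pressure Y phi0) (ratr q) => a b r.
by move: (birkhoff_sum _ _ _) (2 ^- n) => s t; rewrite !ltr_norml; lra.
Qed.

Theorem theoremB (R : realType) (d : nat) (X0 : set (full_shift d))
    (phi0 : full_shift d -> R) (hX0 : shift_space X0) (hphi0 : continuous phi0)
    (hent : forall mu : probability (borel_shift d) R,
       equilibrium_state X0 phi0 mu -> entropy mu <> 0%E) :
  ~ computable_at (@pressure R d) X0 phi0.
Proof.
move=> comp.
have /choice[x /choice[L segP]] := fun n => computable_orbit_segments n hX0 hphi0 comp.
have L_gt n : (n < L n)%N by have [] := segP n.
have xX n k : language X0 _ (window n (iter k (@shift d) (x n))) by have [] := segP n.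
have [U [mu [UU ooU mu_lim mu_inv]]] := @limit_measure_exists R d x L L_gt.
have PU : ProperFilter U := @ultra_proper _ _ UU.
have [_ cX _] := hX0; have [B phiB] := potential_bounded hphi0.
have muX : mu X0 = 1%E by exact: (limit_measure_support UU ooU mu_lim hX0 xX).
have inv : invariant_measure X0 mu by split.
have [I intI] := potential_integral_fin hX0 hphi0 inv.
have PI : pressure X0 phi0 <= I.
  (* The thirds of [e] pay for sampling the integral, sampling the orbit average, and the error
     [3 * 2 ^- n] of the segments. *)
  apply/ler_addgt0Pr => e e0; have e30 : 0 < e / 3 by rewrite divr_gt0.
  have [N NP] := uniform_window hphi0 e30.
  have phie y z : window N y = window N z -> `|phi0 y - phi0 z| <= e / 3.
    by move=> yz; apply/ltW/(NP N).
  have [I' []] := potential_integral_approx hphi0 cX muX phie.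
  rewrite intI => -[<-]; rewrite ler_norml => /andP[IE _].
  suff : pressure X0 phi0 - e / 3 - e / 3 <=
      expect mu (window N) (phi0 \o @word_point d N) by lra.
  have cva := @orbit_average_window _ _ x L U mu UU mu_lim N (phi0 \o @word_point d N).
  rewrite -(cvg_lim _ cva)//; apply: limr_ge; first by apply/cvg_ex; eexists; exact: cva.
  (* From [9 / e < n.+1 <= 2 ^+ n] one gets [3 * 2 ^- n <= e / 3]. *)
  apply: ooU; exists (Num.truncn (9 / e)) => // n /= len.
  have [_ _ avg] := segP n.
  have small : 3 * 2 ^- n <= e / 3.
    rewrite ler_pdivrMr ?exprn_gt0//.
    have : 9 / e < n.+1%:R by rewrite (lt_le_trans (truncnS_gt _))// ler_nat.
    rewrite ltr_pdivrMr// => n9.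
    have : n.+1%:R <= 2 ^+ n :> R by rewrite -natrX ler_nat ltn_expl.
    by move=> n2; have := ler_wpM2r (ltW e0) n2; lra.
  have : orbit_average x L phi0 n <=
      orbit_average x L ((phi0 \o @word_point d N) \o window N) n + e / 3.
    apply: orbit_average_le => // y /=.
    by have := phie _ _ (window_word_point (window N y)); rewrite ler_norml; lra.
  by rewrite -[orbit_average x L phi0 n]/((L n)%:R^-1 * birkhoff_sum phi0 (L n) (x n)); lra.
have leP nu : invariant_measure X0 nu ->
  (free_energy X0 phi0 nu <= (pressure X0 phi0)%:E)%E by exact: free_energy_le.
have ent0 := entropy_ge0 mu.
have geP : ((pressure X0 phi0)%:E <= free_energy X0 phi0 mu)%E.
  rewrite /free_energy intI -[leLHS]add0e leeD//.
have freeE : free_energy X0 phi0 mu = (pressure X0 phi0)%:E.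
  by apply/eqP; rewrite eq_le geP leP.
apply: (hent mu).
  split=> //; apply/eqP; rewrite eq_le; apply/andP; split.
    by apply: ereal_sup_ubound; exists mu.
  by rewrite freeE; apply: ge_ereal_sup => _ [nu nuinv <-]; exact: leP.
(* The entropy of [mu] is squeezed, not computed: it is nonnegative and at most the pressure minus
   [I], hence at most 0 by [PI]. *)
apply/eqP; rewrite eq_le ent0 andbT.
have := leP _ inv; rewrite /free_energy intI -leeBrDr// => /le_trans; apply.
by rewrite -EFinB lee_fin subr_le0.
Qed.
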